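(* Let $(U,\{e_i\}_{i\in I})$ and $(T,\{f_j\}_{j\in J})$ be basic $\mathbb{K}$-algebras with enough idempotents, and let $M$ be a $U$-$T$-bimodule on which $\mathbb{K}$ acts centrally, such that $e_iMf_j$ is a $\mathbb{K}$-module of finite length for all $(i,j)\in I\times J$. Let $\Lambda:=\begin{bmatrix}T&0\\ M&U\end{bmatrix}$ with its idempotents $\{g_r\}_{r\in I\vee J}$, and suppose that $(\Lambda,\{g_r\}_{r\in I\vee J})$ is support finite. Then the following hold. (a) Let $L=(Y,\varphi,X)\in\mathrm{Mod}(\Lambda)$ and suppose $\mathrm{pd}(Mf_j)<\infty$ for all $j\in J$. Then $$L\in\mathcal{P}^{<\infty}_\Lambda\iff Y\in\mathcal{P}^{<\infty}_T\ \text{ and }\ X\in\mathcal{P}^{<\infty}_U.$$ (b) Suppose $m:=\max\{\mathrm{pd}(Mf_j)\}_{j\in J}<\infty$ and let $a:=\mathrm{fin.dim.}(T)$, $\alpha:=\mathrm{gl.dim.}(T)$, $b:=\mathrm{fin.dim.}(U)$, $\beta:=\mathrm{gl.dim.}(U)$. Then $$\max\{\beta-m,\alpha\}\le\mathrm{gl.dim.}(\Lambda)\le\max\{\beta,\alpha+1+m\},$$ $$\max\{b-m,a\}\le\mathrm{fin.dim.}(\Lambda)\le\max\{b,a+1+m\}.$$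
   Context: $\mathbb{K}$ is a fixed commutative ring with unity. Rings and algebras are associative but need not have a unity. A $\mathbb{K}$-algebra with enough idempotents (w.e.i. $\mathbb{K}$-algebra) is a pair $(R,\{e_i\}_{i\in I})$ with $R$ a $\mathbb{K}$-algebra and $\{e_i\}_{i\in I}$ a family of orthogonal idempotents of $R$ such that $R=\bigoplus_{i\in I}e_iR=\bigoplus_{i\in I}Re_i$. $\mathrm{Mod}(R)$ is the category of unitary left $R$-modules ($N$ with $RN=N$) and $\mathrm{mod}(R)$ its full subcategory of finitely generated modules. The algebra is basic if every $e_jRe_i$ is a $\mathbb{K}$-module of finite length, each $e_i$ is primitive, and $Re_i\not\simeq Re_j$ for $e_i\neq e_j$. Bimodules are unitary: $UM=M=MT$. The index sets $I,J$ are nonempty. Triangular algebra: $\Lambda$ consists of the matrices $\begin{bmatrix}t&0\\ m&u\end{bmatrix}$ ($t\in T$, $m\in M$, $u\in U$) with entrywise sum and product $\begin{bmatrix}t&0\\ m&u\end{bmatrix}\begin{bmatrix}t'&0\\ m'&u'\end{bmatrix}=\begin{bmatrix}tt'&0\\ mt'+um'&uu'\end{bmatrix}$. With $I\vee J=(I\times\{1\})\cup(J\times\{2\})$, set $g_{(i,1)}=\begin{bmatrix}0&0\\0&e_i\end{bmatrix}$ and $g_{(j,2)}=\begin{bmatrix}f_j&0\\0&0\end{bmatrix}$. Under the stated hypotheses $(\Lambda,\{g_r\}_{r\in I\vee J})$ is a basic w.e.i. $\mathbb{K}$-algebra. Modules as triples: $\mathrm{Mod}(\Lambda)$ is identified with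 the category of triples $(Y,\varphi,X)$, $Y\in\mathrm{Mod}(T)$, $X\in\mathrm{Mod}(U)$, $\varphi:M\otimes_TY\to X$ a morphism of $U$-modules (morphisms are pairs $(\alpha:Y\to Y',\beta:X\to X')$ with $\beta\varphi=\varphi'(M\otimes\alpha)$). The triple corresponds to the $\Lambda$-module $Y\oplus X$ with $\begin{bmatrix}t&0\\ m&u\end{bmatrix}\cdot(y,x)=(ty,\varphi(m\otimes y)+ux)$. Support finite: $(R,\{e_i\}_{i\in I})$ (each $e_i$ primitive) is support finite if for each $i\in I$ both sets $\{k\in I: e_kRe_i\neq0\}$ and $\{k\in I: e_iRe_k\neq 0\}$ are finite. Dimensions: $\mathrm{pd}(N)$ is the projective dimension of $N$ in the relevant $\mathrm{Mod}$ category, with the convention $\mathrm{pd}(0)=0$. $\mathcal{P}^{<\infty}_R$ is the class of all $N\in\mathrm{mod}(R)$ with $\mathrm{pd}(N)<\infty$. For a class $\mathcal{X}$ of modules, $\mathrm{pd}(\mathcal{X})=\sup\{\mathrm{pd}(N):N\in\mathcal{X}\}$. $\mathrm{gl.dim.}(R):=\mathrm{pd}(\mathrm{mod}(R))$ and $\mathrm{fin.dim.}(R):=\mathrm{pd}(\mathcal{P}^{<\infty}_R)$; these may be $\infty$, with $\infty-m=\infty$ and $\infty+1+m=\infty$. *)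

(* Defs.v *)
From HB Require Import structures.
From mathcomp Require Import all_boot all_order all_algebra.
From mathcomp Require Import boolp classical_sets cardinality fsbigop.
From mathcomp Require Import constructive_ereal ereal.
From mathcomp Require Import generic_quotient ring_quotient freeg.

Set Implicit Arguments.
Unset Strict Implicit.
Unset Printing Implicit Defensive.
Import Order.TTheory GRing.Theory Num.Theory.
Local Open Scope classical_set_scope.
Local Open Scope ring_scope.

(* The rings of the hierarchy of ssralg are all unital, so algebras without
   unity, their modules and their bimodules are introduced here as records over
   the module structures of the library. *)
Record nuAlg (K : comPzRingType) := NuAlg {
  nu_sort :> lmodType K;
  numul : nu_sort -> nu_sort -> nu_sort;
  numulA : associative numul;
  numulDl : left_distributive numul +%R;
  numulDr : right_distributive numul +%R;
  numulZl : forall (k : K) x y, numul (k *: x) y = k *: numul x y;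
  numulZr : forall (k : K) x y, numul x (k *: y) = k *: numul x y }.

Declare Scope nualg_scope.
Open Scope nualg_scope.
Notation "x ** y" := (numul x y) (at level 40, left associativity) : nualg_scope.

Section LeftModules.
Context {K : comPzRingType} {R : nuAlg K}.

Record lmodule := LModule {
  lm_sort :> zmodType;
  lact : R -> lm_sort -> lm_sort;
  lactDl : forall r s x, lact (r + s) x = lact r x + lact s x;
  lactDr : forall r x y, lact r (x + y) = lact r x + lact r y;
  lactA : forall r s x, lact (r ** s) x = lact r (lact s x) }.

(* No K-action is recorded on a unitary module N: since RN = N, it is
   determined by k (r x) = (k r) x, and R-linear maps respect it. *)
Record umodule := UModule {
  um_base :> lmodule;
  um_unitary : forall x : um_base,
    exists s : seq (R * um_base), x = \sum_(p <- s) lact p.1 p.2 }.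

Record lm_hom (V W : lmodule) := Hom {
  hom_fun :> {additive V -> W};
  homZ : forall r x, hom_fun (lact r x) = lact r (hom_fun x) }.

Definition lm_iso (V W : lmodule) : Prop := exists f : lm_hom V W, bijective f.

Definition fin_gen (N : umodule) : Prop :=
  exists s : seq N, forall x : N,
    exists r : N -> R, x = \sum_(y <- s) lact (r y) y.

Definition hom_surj (V W : lmodule) (f : lm_hom V W) : Prop :=
  forall y : W, exists x : V, f x = y.

Definition projective (P : umodule) : Prop :=
  forall (A B : umodule) (g : lm_hom A B) (h : lm_hom P B),
    hom_surj g -> exists h' : lm_hom P A, forall x, g (h' x) = h x.

Record proj_resolution (N : umodule) := ProjResolution {
  pr_obj : nat -> umodule;
  pr_aug : lm_hom (pr_obj 0%N) N;
  pr_diff : forall n, lm_hom (pr_obj n.+1) (pr_obj n);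
  pr_proj : forall n, projective (pr_obj n);
  pr_surj : hom_surj pr_aug;
  pr_exact0 : forall x, pr_aug x = 0 <-> exists y, pr_diff 0%N y = x;
  pr_exactS : forall n x,
    pr_diff n x = 0 <-> exists y, pr_diff n.+1 y = x }.

Definition resolution_le (N : umodule) (r : proj_resolution N) (n : nat) :=
  forall k, (n < k)%N -> forall x : pr_obj r k, x = 0.

(* Homological dimensions are elements n%:R%:E (n : nat) or +oo of \bar rat;
   rat is used because ereal_sup and ereal_inf are only available over a
   realFieldType.  In particular pd of a zero module is 0, and +oo if there is
   no finite resolution. *)
Definition pd (N : umodule) : \bar rat :=
  ereal_inf [set (n%:R)%:E | n in
    [set n : nat | exists r : proj_resolution N, resolution_le r n]].

End LeftModules.
Arguments lmodule {K} R.
Arguments umodule {K} R.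

Definition fin_pd_class {K : comPzRingType} {R : nuAlg K} (N : umodule R) :
    Prop :=
  fin_gen N /\ (pd N < +oo)%E.

Definition pd_class {K : comPzRingType} (R : nuAlg K) (C : umodule R -> Prop) :
    \bar rat :=
  ereal_sup [set d | exists N : umodule R, C N /\ d = pd N].

Definition gldim {K : comPzRingType} (R : nuAlg K) : \bar rat :=
  pd_class (@fin_gen K R).

Definition findim {K : comPzRingType} (R : nuAlg K) : \bar rat :=
  pd_class (@fin_pd_class K R).

Section Submodules.
Context {K : comPzRingType} {R : nuAlg K}.

Definition is_lsub (V : lmodule R) (A : set V) : Prop :=
  [/\ A 0, forall x y, A x -> A y -> A (x - y)
    & forall r x, A x -> A (lact r x)].

Section Sub.
Variables (V : lmodule R) (A : set V) (hA : is_lsub A).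

Definition lsub_pred (_ : is_lsub A) : {pred V} := fun x => `[< A x >].

Lemma lsub_zmod_closed : zmod_closed (lsub_pred hA).
Proof.
have [A0 AB _] := hA; split; first exact/asboolP.
by move=> x y /asboolP Ax /asboolP Ay; apply/asboolP; exact: AB.
Qed.
HB.instance Definition _ :=
  GRing.isZmodClosed.Build V (lsub_pred hA) lsub_zmod_closed.

Record lsub_type : predArgType :=
  LSub { lsub_val :> V; lsubP : lsub_val \in lsub_pred hA }.
HB.instance Definition _ := [isSub for lsub_val].
HB.instance Definition _ := [Choice of lsub_type by <:].
HB.instance Definition _ := [SubChoice_isSubZmodule of lsub_type by <:].

Lemma lsub_act_subproof (r : R) (x : lsub_type) :
  lact r (lsub_val x) \in lsub_pred hA.
Proof.
by have [_ _ Az] := hA; apply/asboolP/Az/asboolP; exact: lsubP x.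
Qed.
Definition lsub_act r x := LSub (lsub_act_subproof r x).

Lemma lsub_actDl r s x : lsub_act (r + s) x = lsub_act r x + lsub_act s x.
Proof. by apply: val_inj; rewrite raddfD /= lactDl. Qed.
Lemma lsub_actDr r x y : lsub_act r (x + y) = lsub_act r x + lsub_act r y.
Proof. by apply: val_inj; rewrite raddfD /= -lactDr. Qed.
Lemma lsub_actA r s x : lsub_act (r ** s) x = lsub_act r (lsub_act s x).
Proof. by apply: val_inj; rewrite /= lactA. Qed.

Definition lsub : lmodule R := LModule lsub_actDl lsub_actDr lsub_actA.

End Sub.
End Submodules.

Section EnoughIdempotents.
Context {K : comPzRingType}.

Definition internal_direct_sum (I : choiceType) (V : zmodType)
    (A : I -> set V) : Prop :=
  forall x : V, exists! c : I -> V,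
    [/\ forall i, A i (c i), finite_set [set i | c i != 0]
      & x = \sum_(i \in [set: I]) c i].

Definition enough_idempotents (I : choiceType) (R : nuAlg K) (e : I -> R) :=
  [/\ forall i, e i ** e i = e i,
      forall i j, i != j -> e i ** e j = 0,
      internal_direct_sum (fun i => [set e i ** r | r in [set: R]])
    & internal_direct_sum (fun i => [set r ** e i | r in [set: R]])].

Definition primitive_idempotent (R : nuAlg K) (e : R) : Prop :=
  [/\ e ** e = e, e <> 0
    & forall f g : R, f ** f = f -> g ** g = g -> f ** g = 0 -> g ** f = 0 ->
        e = f + g -> f = 0 \/ g = 0].

Definition is_submodK (V : lmodType K) (A : set V) : Prop :=
  A 0 /\ forall (k : K) x y, A x -> A y -> A (k *: x + y).

(* A composition series 0 = C 0 < C 1 < ... < C n = A: each C k is a maximal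
   proper submodule of C k.+1, that is, C k.+1 / C k is simple. *)
Definition finite_length (V : lmodType K) (A : set V) : Prop :=
  exists (n : nat) (C : nat -> set V),
    [/\ C 0%N = [set 0], C n = A,
        forall k, (k <= n)%N -> is_submodK (C k)
      & forall k, (k < n)%N ->
          C k `<` C k.+1 /\
          (forall B : set V, is_submodK B -> C k `<=` B -> B `<=` C k.+1 ->
             B = C k \/ B = C k.+1)].

Definition peirce (R : nuAlg K) (e f : R) : set R :=
  [set e ** r ** f | r in [set: R]].

Definition reg_lmodule (R : nuAlg K) : lmodule R :=
  @LModule K R R (@numul K R) (@numulDl K R) (@numulDr K R)
    (fun r s x => esym (numulA r s x)).

Lemma nu0mul (R : nuAlg K) (x : R) : 0 ** x = 0.
Proof. by apply: (addIr (0 ** x)); rewrite -numulDl !add0r. Qed.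
Lemma numul0 (R : nuAlg K) (x : R) : x ** 0 = 0.
Proof. by apply: (addIr (x ** 0)); rewrite -numulDr !add0r. Qed.
Lemma nuNmul (R : nuAlg K) (x y : R) : (- x) ** y = - (x ** y).
Proof. by rewrite -scaleN1r numulZl scaleN1r. Qed.

Lemma left_ideal_is_lsub (R : nuAlg K) (e : R) :
  is_lsub ([set r ** e | r in [set: R]] : set (reg_lmodule R)).
Proof.
split; first by exists 0; rewrite ?nu0mul.
- by move=> _ _ [r _ <-] [s _ <-]; exists (r - s); rewrite // numulDl nuNmul.
- by move=> r _ [s _ <-]; exists (r ** s); rewrite // -numulA.
Qed.

Definition left_ideal (R : nuAlg K) (e : R) : lmodule R :=
  lsub (left_ideal_is_lsub e).

Definition basic (I : choiceType) (R : nuAlg K) (e : I -> R) : Prop :=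
  [/\ enough_idempotents e,
      forall i j, finite_length (peirce (e j) (e i)),
      forall i, primitive_idempotent (e i)
    & forall i j, e i <> e j -> ~ lm_iso (left_ideal (e i)) (left_ideal (e j))].

Definition support_finite (I : choiceType) (R : nuAlg K) (e : I -> R) : Prop :=
  forall i, finite_set [set k | peirce (e k) (e i) <> [set 0]] /\
            finite_set [set k | peirce (e i) (e k) <> [set 0]].

End EnoughIdempotents.

(* The four axioms with Z state that K acts centrally. *)
Record bimodule (K : comPzRingType) (U T : nuAlg K) := Bimodule {
  bi_sort :> lmodType K;
  bil : U -> bi_sort -> bi_sort;
  bir : bi_sort -> T -> bi_sort;
  bilDl : forall u v m, bil (u + v) m = bil u m + bil v m;
  bilDr : forall u m n, bil u (m + n) = bil u m + bil u n;
  bilA : forall u v m, bil (u ** v) m = bil u (bil v m);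
  birDl : forall m n t, bir (m + n) t = bir m t + bir n t;
  birDr : forall m t s, bir m (t + s) = bir m t + bir m s;
  birA : forall m t s, bir m (t ** s) = bir (bir m t) s;
  bilr : forall u m t, bir (bil u m) t = bil u (bir m t);
  bilZl : forall (k : K) u m, bil (k *: u) m = k *: bil u m;
  bilZr : forall (k : K) u m, bil u (k *: m) = k *: bil u m;
  birZl : forall (k : K) m t, bir (k *: m) t = k *: bir m t;
  birZr : forall (k : K) m t, bir m (k *: t) = k *: bir m t;
  bil_unitary : forall m, exists s : seq (U * bi_sort),
    m = \sum_(p <- s) bil p.1 p.2;
  bir_unitary : forall m, exists s : seq (bi_sort * T),
    m = \sum_(p <- s) bir p.1 p.2 }.

Section Bimodules.
Context {K : comPzRingType} {U T : nuAlg K}.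
Variable M : bimodule U T.

Definition bi_peirce (e : U) (f : T) : set M :=
  [set bir (bil e m) f | m in [set: M]].

Definition bi_left : lmodule U :=
  LModule (@bilDl _ _ _ M) (@bilDr _ _ _ M) (@bilA _ _ _ M).

Lemma bir0l (t : T) : bir (0 : M) t = 0.
Proof. by apply: (addIr (bir 0 t)); rewrite -birDl !add0r. Qed.
Lemma bir0r (m : M) : bir m 0 = 0.
Proof. by apply: (addIr (bir m 0)); rewrite -birDr !add0r. Qed.
Lemma bil0l (m : M) : bil 0 m = 0.
Proof. by apply: (addIr (bil 0 m)); rewrite -bilDl !add0r. Qed.
Lemma bil0r (u : U) : bil u (0 : M) = 0.
Proof. by apply: (addIr (bil u 0)); rewrite -bilDr !add0r. Qed.
Lemma birNl (m : M) (t : T) : bir (- m) t = - bir m t.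
Proof. by rewrite -scaleN1r birZl scaleN1r. Qed.

Lemma bi_col_is_lsub (f : T) :
  is_lsub ([set bir m f | m in [set: M]] : set bi_left).
Proof.
split; first by exists 0; rewrite ?bir0l.
- by move=> _ _ [m _ <-] [n _ <-]; exists (m - n); rewrite // birDl birNl.
- by move=> u _ [m _ <-]; exists (bil u m); rewrite // bilr.
Qed.

Lemma bi_col_unitary (f : T) (x : lsub (bi_col_is_lsub f)) :
  exists s : seq (U * lsub (bi_col_is_lsub f)),
    x = \sum_(p <- s) lact p.1 p.2.
Proof.
have /asboolP[m _ xE] := lsubP x.
have [s mE] := bil_unitary m.
have inS (n : M) : bir n f \in lsub_pred (bi_col_is_lsub f).
  by apply/asboolP; exists n.
exists [seq (p.1, LSub (inS p.2)) | p <- s].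
apply: val_inj; rewrite raddf_sum big_map /= -xE {}mE.
rewrite (big_morph (fun n => bir n f) (fun n n' => birDl n n' f) (bir0l f)).
by apply: eq_bigr => p _ /=; rewrite bilr.
Qed.

(* The column M f as an object of the category of unitary left U-modules. *)
Definition bi_col (f : T) : umodule U := UModule (@bi_col_unitary f).

Section Tensor.
Variable Y : lmodule T.

Local Notation free := {freeg (M * Y)%type / int}.
Definition tgen (m : M) (y : Y) : free := << (m, y) >>.

(* The subgroup of the free abelian group on M x Y generated by the defining
   relations of the tensor product over T. *)
Inductive tensor_rel : free -> Prop :=
| TRel0 : tensor_rel 0
| TRelB z w : tensor_rel z -> tensor_rel w -> tensor_rel (z - w)
| TRelDl m n y : tensor_rel (tgen (m + n) y - (tgen m y + tgen n y))
| TRelDr m y z : tensor_rel (tgen m (y + z) - (tgen m y + tgen m z))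
| TRelA m t y : tensor_rel (tgen (bir m t) y - tgen m (lact t y)).

Definition tensor_pred : {pred free} := fun z => `[< tensor_rel z >].

Lemma tensor_zmod_closed : zmod_closed tensor_pred.
Proof.
split; first by apply/asboolP; exact: TRel0.
by move=> z w /asboolP hz /asboolP hw; apply/asboolP; exact: TRelB.
Qed.
HB.instance Definition _ :=
  GRing.isZmodClosed.Build free tensor_pred tensor_zmod_closed.

Definition tensor_type : Type := Quotient.quot tensor_pred.
HB.instance Definition _ := GRing.Zmodule.on tensor_type.

Definition tpi (z : free) : tensor_type :=
  (\pi_(Quotient.quot tensor_pred) z)%qT.

Lemma tpi_is_zmod_morphism : zmod_morphism tpi.
Proof. by move=> z w; rewrite /tpi raddfB. Qed.
HB.instance Definition _ :=
  GRing.isZmodMorphism.Build free tensor_type tpi tpi_is_zmod_morphism.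

Lemma tpi_eq0 z : (tpi z == 0) = (z \in tensor_pred).
Proof.
by rewrite -[z in RHS]subr0 Quotient.idealrBE -[0 in LHS](raddf0 tpi).
Qed.

Lemma tpi_repr (x : tensor_type) : tpi (repr x) = x.
Proof. exact: reprK. Qed.

Definition tens (m : M) (y : Y) : tensor_type := tpi (tgen m y).

Lemma tensDl m n y : tens (m + n) y = tens m y + tens n y.
Proof.
apply/eqP; rewrite -subr_eq0 /tens -!raddfD -raddfB tpi_eq0.
by apply/asboolP; exact: TRelDl.
Qed.
Lemma tensDr m y z : tens m (y + z) = tens m y + tens m z.
Proof.
apply/eqP; rewrite -subr_eq0 /tens -!raddfD -raddfB tpi_eq0.
by apply/asboolP; exact: TRelDr.
Qed.
Lemma tensA m t y : tens (bir m t) y = tens m (lact t y).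
Proof.
apply/eqP; rewrite -subr_eq0 /tens -raddfB tpi_eq0.
by apply/asboolP; exact: TRelA.
Qed.

(* u (m (x) y) = (u m) (x) y *)
Definition tact_free (u : U) : free -> free :=
  fglift (fun p : M * Y => tgen (bil u p.1) p.2).

Lemma tact_free_gen u m y : tact_free u (tgen m y) = tgen (bil u m) y.
Proof. by rewrite /tact_free /tgen liftU scale1r. Qed.

Lemma tact_freeB u : zmod_morphism (tact_free u).
Proof. exact: lift_is_additive. Qed.
HB.instance Definition _ u :=
  GRing.isZmodMorphism.Build free free (tact_free u) (tact_freeB u).

Lemma tact_free_rel u z : tensor_rel z -> tensor_rel (tact_free u z).
Proof.
elim=> [|{}z w _ hz _ hw|m n y|m y y'|m t y].
- by rewrite raddf0; exact: TRel0.
- by rewrite raddfB; exact: TRelB.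
- by rewrite raddfB raddfD /= !tact_free_gen bilDr; exact: TRelDl.
- by rewrite raddfB raddfD /= !tact_free_gen; exact: TRelDr.
- by rewrite raddfB /= !tact_free_gen -bilr; exact: TRelA.
Qed.

Definition tact (u : U) (x : tensor_type) : tensor_type :=
  tpi (tact_free u (repr x)).

Lemma tactE u z : tact u (tpi z) = tpi (tact_free u z).
Proof.
have h : repr (tpi z) - z \in tensor_pred.
  by rewrite -tpi_eq0 raddfB subr_eq0; apply/eqP; exact: tpi_repr.
apply/eqP; rewrite -subr_eq0 /tact -raddfB -raddfB tpi_eq0.
by apply/asboolP/tact_free_rel; exact/asboolP.
Qed.

Lemma tact_tens u m y : tact u (tens m y) = tens (bil u m) y.
Proof. by rewrite tactE tact_free_gen. Qed.

Lemma tactDr u x y : tact u (x + y) = tact u x + tact u y.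
Proof.
by rewrite -[x]tpi_repr -[y]tpi_repr -raddfD !tactE -!raddfD.
Qed.

Lemma tact0 w : tact w 0 = 0.
Proof. by apply: (addIr (tact w 0)); rewrite -tactDr !add0r. Qed.
Lemma tactN w y : tact w (- y) = - tact w y.
Proof.
by apply: (addIr (tact w y)); rewrite -tactDr !addNr tact0.
Qed.

Lemma tens_ind (P : tensor_type -> Prop) :
  (forall m y, P (tens m y)) -> P 0 ->
  (forall x y, P x -> P y -> P (x - y)) -> forall x, P x.
Proof.
move=> Pt P0 PB x; rewrite -[x]tpi_repr.
have PN y : P y -> P (- y) by move=> Py; rewrite -sub0r; exact: PB.
have PD y z : P y -> P z -> P (y + z).
  by move=> Py Pz; rewrite -[z]opprK; apply/PB/PN.
have PM y n : P y -> P (y *+ n).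
  by move=> Py; elim: n => [|n IH]; rewrite ?mulr0n // mulrS; exact: PD.
rewrite -(freeg_sumE (repr x)) raddf_sum; apply: big_rec => // -[m y] z _ Pz.
apply: PD => //.
rewrite -[coeff _ _]intz -freegU_mulz raddfMz.
case: (coeff _ _) => n; rewrite ?NegzE ?mulrNz -?pmulrn; last apply: PN.
- exact/PM/Pt.
- exact/PM/Pt.
Qed.

Lemma tactDl u v x : tact (u + v) x = tact u x + tact v x.
Proof.
elim/tens_ind: x => [m y||x y hx hy]; first by rewrite !tact_tens bilDl tensDl.
  by rewrite !tact0 addr0.
by rewrite !tactDr !tactN hx hy opprD addrACA.
Qed.

Lemma tactA u v x : tact (u ** v) x = tact u (tact v x).
Proof.
elim/tens_ind: x => [m y||x y hx hy]; first by rewrite !tact_tens bilA.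
  by rewrite !tact0.
by rewrite !(tactDr, tactN) hx hy.
Qed.

Definition tensor : lmodule U := LModule tactDl tactDr tactA.

End Tensor.

(* (t, m, u) : T * M * U is the matrix with rows (t, 0) and (m, u); the sum and
   the K-action are the entrywise ones of the product. *)
Definition tri_mul (x y : T * M * U) : T * M * U :=
  (x.1.1 ** y.1.1, bir x.1.2 y.1.1 + bil x.2 y.1.2, x.2 ** y.2).

Lemma tri_mulA : associative tri_mul.
Proof.
move=> [[t m] u] [[t' m'] u'] [[t2 m2] u2]; rewrite /tri_mul /= !numulA.
by rewrite bilDr birDl birA bilA bilr addrA.
Qed.
Lemma tri_mulDl : left_distributive tri_mul +%R.
Proof.
move=> [[t m] u] [[t' m'] u'] [[t2 m2] u2]; rewrite /tri_mul /= !numulDl.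
by rewrite birDl bilDl addrACA.
Qed.
Lemma tri_mulDr : right_distributive tri_mul +%R.
Proof.
move=> [[t m] u] [[t' m'] u'] [[t2 m2] u2]; rewrite /tri_mul /= !numulDr.
by rewrite birDr bilDr addrACA.
Qed.
Lemma tri_mulZl (k : K) x y : tri_mul (k *: x) y = k *: tri_mul x y.
Proof.
case: x y => [[t m] u] [[t' m'] u']; rewrite /tri_mul /= !numulZl birZl bilZl.
by rewrite -scalerDr.
Qed.
Lemma tri_mulZr (k : K) x y : tri_mul x (k *: y) = k *: tri_mul x y.
Proof.
case: x y => [[t m] u] [[t' m'] u']; rewrite /tri_mul /= !numulZr birZr bilZr.
by rewrite -scalerDr.
Qed.

Definition tri_alg : nuAlg K :=
  NuAlg tri_mulA tri_mulDl tri_mulDr tri_mulZl tri_mulZr.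

Definition tri_idem (I J : Type) (e : I -> U) (f : J -> T) (r : I + J) :
    tri_alg :=
  match r with
  | inl i => (0, 0, e i)
  | inr j => (f j, 0, 0)
  end.

Section Triple.
Variables (Y : umodule T) (X : umodule U) (phi : lm_hom (tensor Y) X).

Definition triple_act (l : tri_alg) (z : Y * X) : Y * X :=
  (lact l.1.1 z.1, phi (tens l.1.2 z.1) + lact l.2 z.2).

Lemma triple_actDl r s x :
  triple_act (r + s) x = triple_act r x + triple_act s x.
Proof.
rewrite /triple_act /= !lactDl tensDl raddfD.
by congr (_, _); rewrite addrACA.
Qed.
Lemma triple_actDr r x y :
  triple_act r (x + y) = triple_act r x + triple_act r y.
Proof.
rewrite /triple_act /= !lactDr tensDr raddfD.
by congr (_, _); rewrite addrACA.
Qed.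
Lemma triple_actA r s x :
  triple_act (r ** s) x = triple_act r (triple_act s x).
Proof.
rewrite /triple_act /= !lactA tensDl raddfD tensA -tact_tens lactDr.
have hphi w : phi (tact r.2 w) = lact r.2 (phi w) by exact: (homZ phi r.2 w).
by rewrite hphi addrA.
Qed.

Lemma lact0r (R : nuAlg K) (V : lmodule R) (r : R) : lact r (0 : V) = 0.
Proof. by apply: (addIr (lact r 0)); rewrite -lactDr !add0r. Qed.
Lemma lact0l (R : nuAlg K) (V : lmodule R) (x : V) : lact 0 x = 0.
Proof. by apply: (addIr (lact 0 x)); rewrite -lactDl !add0r. Qed.
Lemma tens0l (y : Y) : tens 0 y = 0.
Proof. by apply: (addIr (tens 0 y)); rewrite -tensDl !add0r. Qed.
Lemma tens0r (m : M) : tens m (0 : Y) = 0.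
Proof. by apply: (addIr (tens m 0)); rewrite -tensDr !add0r. Qed.

Definition triple_lmodule : lmodule tri_alg :=
  @LModule K tri_alg (Y * X)%type triple_act
    triple_actDl triple_actDr triple_actA.

Lemma triple_unitary (z : triple_lmodule) :
  exists s : seq (tri_alg * triple_lmodule), z = \sum_(p <- s) lact p.1 p.2.
Proof.
case: z => y x; have [sy yE] := um_unitary y; have [sx xE] := um_unitary x.
exists ([seq (((p.1, 0, 0) : tri_alg), ((p.2, 0) : triple_lmodule)) | p <- sy]
     ++ [seq (((0, 0, p.1) : tri_alg), ((0, p.2) : triple_lmodule)) | p <- sx]).
rewrite big_cat !big_map /= /triple_act /=.
under eq_bigr do rewrite tens0l raddf0 lact0r addr0.
under [X in _ + X]eq_bigr do rewrite tens0l raddf0 lact0r add0r.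
have -> : \sum_(p <- sy) (lact p.1 p.2, 0) = (y, 0) :> Y * X.
  rewrite yE; elim: (sy) => [|p s IH]; rewrite ?big_nil // !big_cons IH.
  by congr (_, _); rewrite add0r.
have -> : \sum_(p <- sx) (0, lact p.1 p.2) = (0, x) :> Y * X.
  rewrite xE; elim: (sx) => [|p s IH]; rewrite ?big_nil // !big_cons IH.
  by congr (_, _); rewrite add0r.
by congr (_, _); rewrite ?addr0 ?add0r.
Qed.

Definition triple : umodule tri_alg := UModule triple_unitary.

End Triple.
End Bimodules.
Arguments bi_peirce {K U T} M e f.
Arguments bi_col {K U T} M f.
Arguments tensor {K U T} M Y.
Arguments tri_alg {K U T} M.
Arguments tri_idem {K U T} M {I J} e f r.

(* Main.v *)
From HB Require Import structures.
Require Import Defs.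
From mathcomp Require Import all_boot all_order all_algebra.
From mathcomp Require Import boolp classical_sets cardinality fsbigop.
From mathcomp Require Import constructive_ereal ereal.

(* A triangular module V sits in an exact sequence 0 -> X -> V -> Y -> 0, where
   the U-module X and the T-module Y are seen as modules over the triangular
   algebra L.  A U-module has the same projective dimension over L and over U,
   since L acts on it through U and projective U-modules stay projective.  The
   functor V |-> Y is exact and preserves projectives, so pd Y <= pd V.  In the
   other direction, the column of L at f_j is an extension of T f_j by M f_j,
   hence T f_j has dimension at most pd (M f_j) + 1 over L and, by dimension
   shifting, pd_L Y <= pd Y + 1 + m.

   Support finiteness enters through noetherianity: it makes every column
   R e_i, and then every finitely generated module, noetherian, so that
   finitely generated modules have syzygies of the same kind.  In particular
   gl.dim U <= gl.dim L, which is stronger than the stated lower bound. *)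

Set Implicit Arguments.
Unset Strict Implicit.
Unset Printing Implicit Defensive.
Import Order.TTheory GRing.Theory Num.Theory.
Local Open Scope classical_set_scope.
Local Open Scope ring_scope.

(** * Homomorphisms, retracts and short exact sequences *)

(** The absence of a unity shapes the constructions. A submodule of a unitary module is unitary only
    because finitely many ring elements share a local unit, and restriction along the inclusions of
    [U] and [T] into L is not unitary at all, so it has to be cut down to a corner. Projective
    dimension is handled through syzygies ([pdle]) and never through Ext. Modules are compared up to
    [retract]: this is what the argument of Schanuel delivers and [pdle] is stable under it, so no
    isomorphism or complement has to be built. The bound on pd_L Y is known only on the columns T
    f_j, while an arbitrary projective T-module is a summand of a possibly infinite sum of columns.
    With finitely generated syzygies only finite sums of columns occur. The same finiteness lets
    part (a) work without a bound on pd (M f_j) uniform in j. *)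

Section Homs.
Context {K : comPzRingType} {R : nuAlg K}.
Implicit Types A B C D : lmodule R.

Lemma lactNr A (r : R) (x : A) : lact r (- x) = - lact r x.
Proof. by apply: (addIr (lact r x)); rewrite -lactDr !addNr lact0r. Qed.

Lemma lactBr A (r : R) (x y : A) : lact r (x - y) = lact r x - lact r y.
Proof. by rewrite lactDr lactNr. Qed.

Lemma lactNl A (r : R) (x : A) : lact (- r) x = - lact r x.
Proof. by apply: (addIr (lact r x)); rewrite -lactDl !addNr lact0l. Qed.

Lemma lactBl A (r s : R) (x : A) : lact (r - s) x = lact r x - lact s x.
Proof. by rewrite lactDl lactNl. Qed.

Lemma lact_suml A I (l : seq I) (F : I -> R) (x : A) :
  lact (\sum_(i <- l) F i) x = \sum_(i <- l) lact (F i) x.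
Proof.
exact: (big_morph (fun r => lact r x) (fun r s => lactDl r s x) (lact0l x)).
Qed.

Lemma lact_sumr A I (l : seq I) (r : R) (F : I -> A) :
  lact r (\sum_(i <- l) F i) = \sum_(i <- l) lact r (F i).
Proof. exact: (big_morph (lact r) (lactDr r) (lact0r A r)). Qed.

Definition mkhom A B (f : A -> B) (fB : zmod_morphism f)
    (fZ : forall r x, f (lact r x) = lact r (f x)) : lm_hom A B :=
  @Defs.Hom K R A B (HB.pack f (GRing.isZmodMorphism.Build A B f fB)) fZ.

Definition comp_hom A B C (g : lm_hom B C) (f : lm_hom A B) : lm_hom A C.
Proof.
apply: (@mkhom A C (g \o f)) => [x y|r x] /=; first by rewrite !raddfB.
by rewrite !homZ.
Defined.

Definition id_hom A : lm_hom A A.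
Proof. by apply: (@mkhom A A id). Defined.

Definition zero_hom A B : lm_hom A B.
Proof.
apply: (@mkhom A B (fun _ => 0)) => [x y|r x]; first by rewrite subr0.
by rewrite lact0r.
Defined.

Definition add_hom A B (f g : lm_hom A B) : lm_hom A B.
Proof.
apply: (@mkhom A B (fun x => f x + g x)) => [x y|r x].
  by rewrite !raddfB addrACA -opprD.
by rewrite !homZ lactDr.
Defined.

Definition opp_hom A B (f : lm_hom A B) : lm_hom A B.
Proof.
apply: (@mkhom A B (fun x => - f x)) => [x y|r x]; first by rewrite raddfB opprD.
by rewrite homZ lactNr.
Defined.

(** Preimages under an injective homomorphism are unique, so any choice of them is automatically
    additive and linear. Most maps between syzygies below are obtained in this way. *)
Lemma hom_factor A B D (i : lm_hom A B) (h : lm_hom D B) :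
  injective i -> (forall x, exists a, i a = h x) ->
  exists k : lm_hom D A, forall x, i (k x) = h x.
Proof.
move=> inji /choice[k kP].
suff [kB kZ] : zmod_morphism k /\ forall r x, k (lact r x) = lact r (k x).
  by exists (mkhom kB kZ).
by split=> [x y|r x]; apply: inji; rewrite ?raddfB ?homZ !kP ?raddfB ?homZ.
Qed.

(** A direct summand up to isomorphism, with the complement left unnamed. *)
Definition retract A B :=
  exists (i : lm_hom A B) (p : lm_hom B A), cancel i p.

Definition ses A B C := exists (i : lm_hom A B) (p : lm_hom B C),
  [/\ injective i, hom_surj p & forall x, p x = 0 <-> exists a, i a = x].

Lemma hom_inj0 A B (f : lm_hom A B) :
  (forall x, f x = 0 -> x = 0) -> injective f.
Proof.
move=> f0 x y fxy; apply/eqP; rewrite -subr_eq0; apply/eqP/f0.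
by rewrite raddfB fxy subrr.
Qed.

Lemma bij_retract A B (f : lm_hom A B) :
  injective f -> hom_surj f -> retract A B /\ retract B A.
Proof.
move=> injf surjf; have [g gP] := hom_factor (h := id_hom B) injf surjf.
split; first by exists f, g => x; apply: injf; rewrite gP.
by exists g, f => x; rewrite gP.
Qed.

Lemma unitary_of A : (forall x : A, exists r, lact r x = x) ->
  forall x : A, exists s : seq (R * A), x = \sum_(p <- s) lact p.1 p.2.
Proof. by move=> h x; have [r <-] := h x; exists [:: (r, x)]; rewrite big_seq1. Qed.

Definition dsum_act A B (r : R) (x : A * B) : A * B := (lact r x.1, lact r x.2).
Definition dsum_lmodule A B : lmodule R.
Proof.
apply: (@LModule K R (A * B)%type (@dsum_act A B)); rewrite /dsum_act.
- by move=> r s x; rewrite !lactDl.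
- by move=> r x y; rewrite !lactDr.
- by move=> r s x; rewrite !lactA.
Defined.

(** Row vectors of length 0 supply a one-element group that already is a [zmodType]. *)
Definition zero_act (r : R) (x : 'rV[int]_0) : 'rV[int]_0 := 0.
Definition zero_lmodule : lmodule R.
Proof.
apply: (@LModule K R 'rV[int]_0 zero_act); rewrite /zero_act => *.
- by rewrite addr0.
- by rewrite addr0.
- by [].
Defined.
Lemma zero_lmodule_eq0 (x : zero_lmodule) : x = 0.
Proof. exact: thinmx0. Qed.

Definition zero_mod : umodule R.
Proof.
apply: (@UModule K R zero_lmodule) => x; exists [::].
by rewrite big_nil; exact: zero_lmodule_eq0.
Defined.

Definition dsum (A B : umodule R) : umodule R.
Proof.
apply: (@UModule K R (dsum_lmodule A B)) => -[x y].
have [s ->] := um_unitary x; have [t ->] := um_unitary y.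
exists ([seq (p.1, ((p.2, 0) : dsum_lmodule A B)) | p <- s] ++
        [seq (p.1, ((0, p.2) : dsum_lmodule A B)) | p <- t]).
rewrite big_cat !big_map /= /dsum_act /=.
have -> : \sum_(p <- s) (lact p.1 p.2, lact p.1 0) =
    (\sum_(p <- s) lact p.1 p.2, 0) :> A * B.
  elim: s => [|p s IH]; rewrite ?big_nil // !big_cons IH.
  by congr (_, _); rewrite lact0r addr0.
have -> : \sum_(p <- t) (lact p.1 0, lact p.1 p.2) =
    (0, \sum_(p <- t) lact p.1 p.2) :> A * B.
  elim: t => [|p t IH]; rewrite ?big_nil // !big_cons IH.
  by congr (_, _); rewrite lact0r addr0.
by congr (_, _); rewrite ?addr0 ?add0r.
Defined.

Definition inl_hom A B : lm_hom A (dsum_lmodule A B).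
Proof.
apply: (@mkhom A (dsum_lmodule A B) (fun x => (x, 0))) => [x y|r x].
  by congr (_, _); rewrite subr0.
by congr (_, _); rewrite lact0r.
Defined.
Definition inr_hom A B : lm_hom B (dsum_lmodule A B).
Proof.
apply: (@mkhom B (dsum_lmodule A B) (fun x => (0, x))) => [x y|r x].
  by congr (_, _); rewrite subr0.
by congr (_, _); rewrite lact0r.
Defined.
Definition fst_hom A B : lm_hom (dsum_lmodule A B) A.
Proof. by apply: (@mkhom (dsum_lmodule A B) A fst). Defined.
Definition snd_hom A B : lm_hom (dsum_lmodule A B) B.
Proof. by apply: (@mkhom (dsum_lmodule A B) B snd). Defined.

Definition pair_hom D A B (f : lm_hom D A) (g : lm_hom D B) :
    lm_hom D (dsum_lmodule A B).
Proof.
apply: (@mkhom D (dsum_lmodule A B) (fun x => (f x, g x))) => [x y|r x].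
  by rewrite !raddfB.
by rewrite !homZ.
Defined.
Definition copair_hom A B D (f : lm_hom A D) (g : lm_hom B D) :
    lm_hom (dsum_lmodule A B) D :=
  add_hom (comp_hom f (fst_hom A B)) (comp_hom g (snd_hom A B)).

Lemma ses_dsum (A B : umodule R) : ses A (dsum A B) B.
Proof.
exists (inl_hom A B), (snd_hom A B); split.
- by move=> x y [].
- by move=> y; exists (0, y).
- move=> [x y] /=; split=> [->|[a [_ <-]]] //; by exists x.
Qed.

Lemma retract_inl (A B : umodule R) : retract A (dsum A B).
Proof. by exists (inl_hom A B), (fst_hom A B). Qed.
End Homs.

(** * Projective dimension *)

Definition local_units {K : comPzRingType} (R : nuAlg K) :=
  forall s : seq R, exists u : R, forall r, r \in s -> u ** r = r.

Section ProjectiveDimension.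
Context {K : comPzRingType} {R : nuAlg K} (hR : local_units R).
Implicit Types A B C N P Z : umodule R.

(** Each x is a finite sum of elements r y, so a unit for the finitely many coefficients r fixes
    x. *)
Lemma local_unit_act N (l : seq N) :
  exists u : R, forall x, x \in l -> lact u x = x.
Proof.
suff [s sP] : exists s : seq R, forall u, (forall r, r \in s -> u ** r = r) ->
    forall x, x \in l -> lact u x = x.
  by have [u uP] := hR s; exists u; exact: sP.
elim: l => [|y l [s sP]]; first by exists [::].
have [t yE] := um_unitary y; exists (map fst t ++ s) => u uP x.
rewrite inE => /predU1P[->|xl]; last first.
  by apply: sP xl => r rs; apply: uP; rewrite mem_cat rs orbT.
rewrite [in RHS]yE [in LHS]yE lact_sumr !big_seq; apply: eq_bigr => p pt.
by rewrite -lactA uP // mem_cat map_f.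
Qed.

Lemma local_unit1 N (x : N) : exists u : R, lact u x = x.
Proof. by have [u uP] := local_unit_act [:: x]; exists u; rewrite uP ?inE. Qed.

Definition sub_umod N (S : set N) (hS : is_lsub S) : umodule R.
Proof.
apply: (@UModule K R (lsub hS)); apply: unitary_of => x.
have [u uP] := local_unit1 (lsub_val x); exists u.
exact: val_inj.
Defined.

Definition sub_hom N (S : set N) (hS : is_lsub S) : lm_hom (sub_umod hS) N.
Proof. by apply: (@mkhom K R (sub_umod hS) N (@lsub_val K R N S hS)). Defined.

Lemma sub_hom_inj N (S : set N) (hS : is_lsub S) : injective (sub_hom hS).
Proof. exact: val_inj. Qed.

Lemma sub_homP N (S : set N) (hS : is_lsub S) (x : N) :
  S x <-> exists a, sub_hom hS a = x.
Proof.
split=> [Sx|[a <-]]; last exact/asboolP/lsubP.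
have xS : x \in lsub_pred hS by apply/asboolP.
by exists (LSub xS).
Qed.

Lemma ker_is_lsub (A B : lmodule R) (p : lm_hom A B) : is_lsub [set x | p x = 0].
Proof.
split=> /=; first by rewrite raddf0.
  by move=> x y px py; rewrite raddfB px py subrr.
by move=> r x px; rewrite homZ px lact0r.
Qed.

Lemma kernel_ses A B (p : lm_hom A B) : hom_surj p ->
  exists Z (i : lm_hom Z A),
    injective i /\ forall x, p x = 0 <-> exists a, i a = x.
Proof.
move=> psurj; exists (sub_umod (ker_is_lsub p)), (sub_hom (ker_is_lsub p)).
by split; [exact: sub_hom_inj | exact: sub_homP].
Qed.

Lemma lift_proj P A B (g : lm_hom A B) (h : lm_hom P B) :
  projective P -> hom_surj g -> exists k : lm_hom P A, forall x, g (k x) = h x.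
Proof. by move=> pP gs; exact: pP. Qed.

Lemma projective_retract A B : retract A B -> projective B -> projective A.
Proof.
move=> [i [p ip]] pB X Y g h gs.
have [k kP] := pB _ _ g (comp_hom h p) gs.
by exists (comp_hom k i) => x /=; rewrite kP /= ip.
Qed.

Lemma projective_dsum A B : projective A -> projective B -> projective (dsum A B).
Proof.
move=> pA pB X Y g h gs.
have [k kP] := pA _ _ g (comp_hom h (inl_hom A B)) gs.
have [l lP] := pB _ _ g (comp_hom h (inr_hom A B)) gs.
exists (copair_hom k l) => -[x y] /=; rewrite raddfD kP lP /= -raddfD.
by congr (h (_, _)); rewrite ?addr0 ?add0r.
Qed.

Lemma projective_eq0 N : (forall x : N, x = 0) -> projective N.
Proof.
move=> N0 X Y g h gs; exists (zero_hom N X) => x.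
by rewrite [x]N0 !raddf0.
Qed.

(** With a section s of p, the element b is sent to (b - s (p b), p b), whose first entry lies in
    the image of A. *)
Lemma ses_splits A B C : ses A B C -> projective C -> retract B (dsum A C).
Proof.
move=> [i [p [inji ps ex]]] pC.
have [s sP] := lift_proj (id_hom C) pC ps.
pose h := add_hom (id_hom B) (opp_hom (comp_hom s p)).
have [k kP] : exists k : lm_hom B A, forall x, i (k x) = h x.
  by apply: hom_factor => // x; apply/ex; rewrite /= raddfB sP subrr.
exists (pair_hom k p), (copair_hom i s) => x /=.
by rewrite kP /= subrK.
Qed.

(* With lifts a : P -> P' and b : P' -> P over N, the identity
   z = (z - b (a z)) + b (a z) exhibits the retraction. *)
Lemma schanuel Z P Z' P' N : ses Z P N -> ses Z' P' N ->
  projective P -> projective P' -> retract Z (dsum Z' P).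
Proof.
move=> [i [p [inji ps ex]]] [i' [p' [inji' ps' ex']]] pP pP'.
have [a aP] := lift_proj p pP ps'.
have [b bP] := lift_proj p' pP' ps.
have pi x : p (i x) = 0 by apply/ex; exists x.
have pi' x : p' (i' x) = 0 by apply/ex'; exists x.
have [k kP] : exists k : lm_hom Z Z', forall x, i' (k x) = a (i x).
  by apply: (hom_factor (h := comp_hom a i)) => // x; apply/ex'; rewrite /= aP pi.
have [l lP] : exists l : lm_hom Z' Z, forall x, i (l x) = b (i' x).
  by apply: (hom_factor (h := comp_hom b i')) => // x; apply/ex; rewrite /= bP pi'.
pose h := add_hom (id_hom P) (opp_hom (comp_hom b a)).
have [m mP] : exists m : lm_hom P Z, forall x, i (m x) = h x.
  by apply: hom_factor => // x; apply/ex; rewrite /= raddfB bP aP subrr.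
exists (pair_hom k i), (copair_hom l m) => x /=.
by apply: inji; rewrite raddfD lP mP /= kP addrC subrK.
Qed.

(** Iterated syzygies, a form suited to induction on n. Only one presentation is asked for; by
    [pdle_syzygy] every projective presentation then serves. *)
Fixpoint pdle (n : nat) N : Prop :=
  if n is m.+1 then exists P Z, [/\ projective P, ses Z P N & pdle m Z]
  else projective N.

Lemma ses_eq0 A N : (forall x : A, x = 0) -> ses A N N.
Proof.
move=> A0; exists (zero_hom A N), (id_hom N); split.
- by move=> x y _; rewrite [x]A0 [y]A0.
- by move=> y; exists y.
- by move=> x /=; split=> [->|[_ <-]] //; exists 0.
Qed.

Lemma pdleS n N : pdle n N -> pdle n.+1 N.
Proof.
elim: n N => [|n IH] N; last by move=> [P [Z [pP s /IH]]]; exists P, Z.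
move=> pN; exists N, zero_mod; split=> //.
  exact: (ses_eq0 (A := zero_mod) _ zero_lmodule_eq0).
exact: (projective_eq0 (N := zero_mod) zero_lmodule_eq0).
Qed.

Lemma pdle_mono m n N : (m <= n)%N -> pdle m N -> pdle n N.
Proof.
move=> /subnK<-; elim: (n - m)%N => //= k IH /IH; exact: pdleS.
Qed.

Lemma projective_pdle n N : projective N -> pdle n N.
Proof. by move=> pN; apply: (@pdle_mono 0). Qed.

(** The horseshoe construction: PC -> C lifts through p, so PA + PC covers B, and the kernels form
    an exact sequence 0 -> ZA -> Z -> ZC -> 0 to which induction applies. *)
Lemma pdle_ext n A B C : ses A B C -> pdle n A -> pdle n C -> pdle n B.
Proof.
elim: n A B C => [|n IH] A B C s.
  move=> pA pC; apply: projective_retract (ses_splits s pC) _.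
  exact: projective_dsum.
move: s => [i [p [inji ps ex]]].
move=> [PA [ZA [pPA [iA [qA [injiA qAs exA]]] dZA]]].
move=> [PC [ZC [pPC [iC [qC [injiC qCs exC]]] dZC]]].
have [l lP] := lift_proj qC pPC ps.
have pi x : p (i x) = 0 by apply/ex; exists x.
pose q := copair_hom (comp_hom i qA) l : lm_hom (dsum PA PC) B.
have qs : hom_surj q.
  move=> y; have [c cE] := qCs (p y).
  have /ex[a aE] : p (y - l c) = 0 by rewrite raddfB lP cE subrr.
  have [x xE] := qAs a; exists (x, c) => /=.
  by rewrite xE aE subrK.
have [Z [j [injj exj]]] := kernel_ses qs.
have qj x : q (j x) = 0 by apply/exj; exists x.
exists (dsum PA PC), Z; split; [exact: projective_dsum | by exists j, q|].
apply: (IH ZA _ ZC) => //.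
have qiA x : qA (iA x) = 0 by apply/exA; exists x.
have [u uP] : exists u : lm_hom ZA Z, forall x, j (u x) = (iA x, 0).
  apply: (hom_factor (h := comp_hom (inl_hom PA PC) iA)) => // x.
  by apply/exj; rewrite /= qiA raddf0 raddf0 addr0.
have [v vP] : exists v : lm_hom Z ZC, forall x, iC (v x) = (j x).2.
  apply: (hom_factor (h := comp_hom (snd_hom PA PC) j)) => // x; apply/exC => /=.
  by rewrite -lP -[RHS](raddf0 p) -(qj x) /= raddfD pi add0r.
exists u, v; split.
- by move=> x y /(congr1 j); rewrite !uP => -[/injiA].
(* Surjectivity of Z -> ZC: the lift of z in B comes from A, and a preimage of its opposite in PA
   completes z to an element of Z. *)
- move=> z; have /ex[a aE] : p (- l (iC z)) = 0.
    by rewrite raddfN lP; apply/eqP; rewrite oppr_eq0; apply/eqP/exC; exists z.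
  have [x xE] := qAs a.
  have /exj[w wE] : q (x, iC z) = 0 by rewrite /= xE aE addNr.
  by exists w; apply: injiC; rewrite vP wE.
- move=> x; split=> [vx0|[a <-]]; last first.
    by apply: injiC; rewrite vP uP raddf0.
  have jx2 : (j x).2 = 0 by rewrite -vP vx0 raddf0.
  have /exA[a aE] : qA (j x).1 = 0.
    by apply: inji; rewrite raddf0 -(qj x) /= jx2 raddf0 addr0.
  by exists a; apply: injj; rewrite uP aE -jx2 -surjective_pairing.
Qed.

Lemma pdle_dsum n A B : pdle n A -> pdle n B -> pdle n (dsum A B).
Proof. exact: pdle_ext (ses_dsum A B). Qed.

(* If e on P lifts the idempotent of B with image A, then
   z = e z + (z - e z) makes the kernel of P -> B -> A a retract of Z + P. *)
Lemma pdle_retract n A B : retract A B -> pdle n B -> pdle n A.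
Proof.
elim: n A B => [|n IH] A B; first exact: projective_retract.
move=> [i [p ip]] [P [Z [pP [iZ [q [injiZ qs ex]]] dZ]]].
have rs : hom_surj (comp_hom p q).
  by move=> y; have [x xE] := qs (i y); exists x; rewrite /= xE ip.
have [Z' [j [injj exj]]] := kernel_ses rs.
exists P, Z'; split=> //; first by exists j, (comp_hom p q).
apply: (IH _ (dsum Z P)); last exact/pdle_dsum/projective_pdle.
have [e eP] := lift_proj (comp_hom i (comp_hom p q)) pP qs.
have pqj x : p (q (j x)) = 0 by apply/exj; exists x.
have qiZ x : q (iZ x) = 0 by apply/ex; exists x.
have [k kP] : exists k : lm_hom Z' Z, forall x, iZ (k x) = e (j x).
  apply: (hom_factor (h := comp_hom e j)) => // x; apply/ex.
  by rewrite /= eP /= pqj raddf0.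
have [l lP] : exists l : lm_hom Z Z', forall x, j (l x) = iZ x.
  by apply: hom_factor => // x; apply/exj; rewrite /= qiZ raddf0.
pose h := add_hom (id_hom P) (opp_hom e).
have [m mP] : exists m : lm_hom P Z', forall x, j (m x) = h x.
  apply: hom_factor => // x; apply/exj; rewrite /= !raddfB eP /= ip subrr //.
exists (pair_hom k j), (copair_hom l m) => x /=.
by apply: injj; rewrite raddfD lP mP /= kP addrC subrK.
Qed.

(** If Z is the kernel of P -> B, the kernel Z' of the composite P -> B -> C sits in 0 -> Z -> Z' ->
    A -> 0, and both ends have dimension at most n. *)
Lemma pdle_coker n A B C : ses A B C -> pdle n A -> pdle n.+1 B -> pdle n.+1 C.
Proof.
move=> [i [p [inji ps ex]]] dA [P [Z [pP [j [q [injj qs exq]]] dZ]]].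
have rs : hom_surj (comp_hom p q).
  by move=> y; have [b bE] := ps y; have [x xE] := qs b; exists x; rewrite /= xE.
have [Z' [k [injk exk]]] := kernel_ses rs.
exists P, Z'; split=> //; first by exists k, (comp_hom p q).
apply: (@pdle_ext n Z Z' A) => //.
have pqk x : p (q (k x)) = 0 by apply/exk; exists x.
have qj x : q (j x) = 0 by apply/exq; exists x.
have [u uP] : exists u : lm_hom Z Z', forall x, k (u x) = j x.
  by apply: hom_factor => // x; apply/exk; rewrite /= qj raddf0.
have [v vP] : exists v : lm_hom Z' A, forall x, i (v x) = q (k x).
  by apply: (hom_factor (h := comp_hom q k)) => // x; apply/ex; rewrite /= pqk.
exists u, v; split.
- by move=> x y /(congr1 k); rewrite !uP => /injj.
- move=> a; have [x xE] := qs (i a).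
  have /exk[w wE] : comp_hom p q x = 0 by rewrite /= xE; apply/ex; exists a.
  by exists w; apply: inji; rewrite vP wE.
- move=> x; split=> [vx0|[a <-]]; last by apply: inji; rewrite vP uP qj raddf0.
  have /exq[a aE] : q (k x) = 0 by rewrite -vP vx0 raddf0.
  by exists a; apply: injk; rewrite uP.
Qed.

(** The pullback of P -> C along B -> C splits over P, hence is A + P. Its projection to B has
    kernel Z, so A + P is an extension of B by Z, and A is a retract of it. *)
Lemma pdle_ker n A B C : ses A B C -> pdle n B -> pdle n.+1 C -> pdle n A.
Proof.
move=> [i [p [inji ps ex]]] dB [P [Z [pP [j [q [injj qs exq]]] dZ]]].
have [l lP] := lift_proj q pP ps.
have pi x : p (i x) = 0 by apply/ex; exists x.
have qj x : q (j x) = 0 by apply/exq; exists x.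
apply: (pdle_retract (retract_inl A P)).
apply: (@pdle_ext n Z (dsum A P) B) => //.
pose h := opp_hom (comp_hom l j).
have [k kP] : exists k : lm_hom Z A, forall x, i (k x) = h x.
  by apply: hom_factor => // x; apply/ex; rewrite /= raddfN lP qj oppr0.
exists (pair_hom k j), (copair_hom i l); split.
- by move=> x y [_ /injj].
- move=> b; have [x xE] := qs (p b).
  have /ex[a aE] : p (b - l x) = 0 by rewrite raddfB lP xE subrr.
  by exists (a, x); rewrite /= aE subrK.
- move=> [a x] /=; split=> [/eqP|[z [<- <-]]]; last by rewrite kP /= addNr.
  rewrite addr_eq0 => /eqP iaE.
  have /exq[z zE] : q x = 0 by rewrite -lP -[RHS]oppr0 -(pi a) iaE raddfN opprK.
  by exists z; congr (_, _) => //; apply: inji; rewrite kP /= zE iaE.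
Qed.

Lemma pdle_syzygy n Z P N :
  ses Z P N -> projective P -> pdle n.+1 N -> pdle n Z.
Proof.
move=> s pP [Q [W [pQ t dW]]]; apply: pdle_retract (schanuel s t pP pQ) _.
exact/pdle_dsum/projective_pdle.
Qed.

(** Dropping the first term leaves a resolution of the first syzygy, with augmentation the
    corestriction b of the first differential. *)
Lemma resolution_pdle n N (r : proj_resolution N) :
  resolution_le r n -> pdle n N.
Proof.
elim: n N r => [|n IH] N [P a d pP as_ ex0 exS] /= rn.
  have inja : injective a.
    (* The term of degree 1 vanishes, so exactness makes the augmentation an isomorphism. *)
    apply: hom_inj0 => x /ex0[y <-]; have y0 : y = 0 by exact: rn.
    by rewrite y0 raddf0.
  by apply: projective_retract (bij_retract inja as_).2 (pP 0%N).
have [Z [i [inji exi]]] := kernel_ses as_.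
exists (P 0%N), Z; split=> //; first by exists i, a.
have [b bP] : exists b : lm_hom (P 1%N) Z, forall x, i (b x) = d 0%N x.
  by apply: hom_factor => // x; apply/exi/ex0; exists x.
have bs : hom_surj b.
  move=> z; have /ex0[y yE] : a (i z) = 0 by apply/exi; exists z.
  by exists y; apply: inji; rewrite bP.
have bex x : b x = 0 <-> exists y, d 1%N y = x.
  rewrite -exS -bP; split=> [->|ibx0]; first by rewrite raddf0.
  by apply: inji; rewrite raddf0.
pose r' := @ProjResolution K R Z (fun k => P k.+1) b (fun k => d k.+1)
  (fun k => pP k.+1) bs bex (fun k => exS k.+1).
by apply: (IH Z r') => k nk; apply: rn.
Qed.

(** A resolution of the syzygy Z is spliced to Q through the composite P 0 -> Z -> Q. *)
Lemma pdle_resolution n N :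
  pdle n N -> exists r : proj_resolution N, resolution_le r n.
Proof.
elim: n N => [|n IH] N.
  move=> pN; pose P (k : nat) := if k is k'.+1 then zero_mod else N.
  pose d k : lm_hom (P k.+1) (P k) := zero_hom _ _.
  have pP k : projective (P k).
    by case: k => // k; exact: (projective_eq0 (N := zero_mod) zero_lmodule_eq0).
  have ids : hom_surj (id_hom N) by move=> x; exists x.
  have ex0 (x : N) : id_hom N x = 0 <-> exists y, d 0%N y = x.
    by split=> [/= ->|[y <-]] //; exists 0.
  have exS k x : d k x = 0 <-> exists y, d k.+1 y = x.
    by split=> [_|_] //; exists 0; rewrite [x]zero_lmodule_eq0.
  exists (@ProjResolution K R N P (id_hom N) d pP ids ex0 exS) => -[|k] //= _ x.
  exact: thinmx0.
move=> [Q [Z [pQ [i [p [inji ps ex]]] /IH[[P a d pP as_ ex0 exS] /= rn]]]].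
pose P' (k : nat) := if k is k'.+1 then P k' else Q.
pose d' k : lm_hom (P' k.+1) (P' k) :=
  if k is k'.+1 then d k' else comp_hom i a.
have pP' k : projective (P' k) by case: k.
have ex0' (x : Q) : p x = 0 <-> exists y, d' 0%N y = x.
  rewrite ex; split=> [[z <-]|[y <-]]; last by exists (a y).
  by have [y <-] := as_ z; exists y.
have exS' k x : d' k x = 0 <-> exists y, d' k.+1 y = x.
  case: k x => [|k] x; last exact: exS.
  apply: iff_trans (ex0 x); split=> /= [iax0|->]; last by rewrite raddf0.
  by apply: inji; rewrite raddf0.
exists (@ProjResolution K R N P' p d' pP' ps ex0' exS') => -[|k] //=.
exact: rn.
Qed.

Definition finpd N := exists n, pdle n N.

Lemma finpd_ses A B C : ses A B C ->
  [/\ finpd A -> finpd C -> finpd B, finpd A -> finpd B -> finpd C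
    & finpd B -> finpd C -> finpd A].
Proof.
move=> s; split=> -[m dm] [n dn]; exists (maxn m n).+1.
- apply: (pdle_ext s); [apply: pdle_mono dm | apply: pdle_mono dn];
  by rewrite ltnW // ltnS ?leq_maxl ?leq_maxr.
- apply: (pdle_coker s); [apply: pdle_mono dm | apply: pdle_mono dn].
    exact: leq_maxl.
  by rewrite ltnW // ltnS leq_maxr.
- apply: (pdle_ker s); [apply: pdle_mono dm | apply: pdle_mono dn];
  by rewrite ltnW // ?ltnS ?leq_maxl ?leq_maxr // ltnW // ltnS leq_maxr.
Qed.

Lemma finpd_retract A B : retract A B -> finpd B -> finpd A.
Proof. by move=> r [n dn]; exists n; exact: pdle_retract r dn. Qed.

End ProjectiveDimension.

(** * Noetherian modules and finitely generated resolutions *)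

Section Noetherian.
Context {K : comPzRingType} {R : nuAlg K} (hR : local_units R).
Implicit Types A B C N P Z : umodule R.

(** Generation is expressed by minimality rather than by linear combinations: this passes directly
    through images and preimages, and without a unity the combinations of s contain s only thanks to
    local units. *)
Definition lsub_gen (V : lmodule R) (S : set V) := exists s : seq V,
  (forall y, y \in s -> S y) /\
  forall D, is_lsub D -> (forall y, y \in s -> D y) -> S `<=` D.

Definition noetherian (V : lmodule R) := forall S : set V, is_lsub S -> lsub_gen S.

Lemma lsub0 (V : lmodule R) (S : set V) : is_lsub S -> S 0.
Proof. by case. Qed.
Lemma lsubB (V : lmodule R) (S : set V) x y : is_lsub S -> S x -> S y -> S (x - y).
Proof. by case=> _ + _; apply. Qed.
Lemma lsubZ (V : lmodule R) (S : set V) r x : is_lsub S -> S x -> S (lact r x).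
Proof. by case=> _ _; apply. Qed.
Lemma lsubD (V : lmodule R) (S : set V) x y : is_lsub S -> S x -> S y -> S (x + y).
Proof.
move=> hS Sx Sy; rewrite -[y]opprK; apply: lsubB => //.
by rewrite -sub0r; apply: lsubB => //; exact: lsub0.
Qed.
Lemma lsub_sum (V : lmodule R) (S : set V) (I : eqType) (l : seq I) (F : I -> V) :
  is_lsub S -> (forall i, i \in l -> S (F i)) -> S (\sum_(i <- l) F i).
Proof.
move=> hS Sl; rewrite big_seq; apply: big_ind => //; first exact: lsub0.
by move=> x y; exact: lsubD.
Qed.

Lemma preim_is_lsub (V W : lmodule R) (f : lm_hom V W) (S : set W) :
  is_lsub S -> is_lsub (f @^-1` S).
Proof.
move=> hS; split=> /=.
- by rewrite raddf0; exact: lsub0.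
- by move=> x y Sx Sy; rewrite raddfB; exact: lsubB.
- by move=> r x Sx; rewrite homZ; exact: lsubZ.
Qed.

Lemma image_is_lsub (V W : lmodule R) (f : lm_hom V W) (S : set V) :
  is_lsub S -> is_lsub (f @` S).
Proof.
move=> hS; split=> /=.
- by exists 0; [exact: lsub0 | rewrite raddf0].
- by move=> _ _ [x Sx <-] [y Sy <-]; exists (x - y); [exact: lsubB | rewrite raddfB].
- by move=> r _ [x Sx <-]; exists (lact r x); [exact: lsubZ | rewrite homZ].
Qed.

Lemma setT_is_lsub (V : lmodule R) : is_lsub [set: V].
Proof. by []. Qed.

Lemma fin_genP N : fin_gen N <-> lsub_gen [set: N].
Proof.
split=> [[s sP]|[s [_ sP]]].
  exists s; split=> // D hD sD x _; have [r ->] := sP x.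
  by apply: lsub_sum => // y /sD; exact: lsubZ.
(* The coefficients are a function of the generator, so a repeated generator would be counted
   several times when y is written as u y. *)
exists (undup s) => x.
pose D := [set x : N | exists r : N -> R, x = \sum_(y <- undup s) lact (r y) y].
suff : D x by [].
apply: sP => //; first split.
- by exists (fun _ => 0); rewrite big1 // => y _; rewrite lact0l.
- move=> _ _ [r ->] [r' ->]; exists (fun y => r y - r' y).
  by rewrite -sumrB; apply: eq_bigr => y _; rewrite lactBl.
- move=> t _ [r ->]; exists (fun y => t ** r y).
  by rewrite lact_sumr; apply: eq_bigr => y _; rewrite lactA.
move=> y ys; have [u uP] := local_unit1 hR y.
exists (fun z => if z == y then u else 0).
rewrite (bigD1_seq y) ?undup_uniq ?mem_undup //= eqxx uP big1 ?addr0 //.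
by move=> z /negbTE->; rewrite lact0l.
Qed.

Lemma lsub_gen_image (V W : lmodule R) (f : lm_hom V W) (S : set V) :
  lsub_gen S -> lsub_gen (f @` S).
Proof.
move=> [s [sS sP]]; exists (map f s); split.
  by move=> _ /mapP[y /sS Sy ->]; exists y.
move=> D hD sD _ [x Sx <-]; apply: (sP (f @^-1` D)) => //.
  exact: preim_is_lsub.
by move=> y ys; apply: sD; exact: map_f.
Qed.

Lemma lsub_gen_ext (A B C : lmodule R) (i : lm_hom A B) (p : lm_hom B C)
    (S : set B) :
  (forall x, p x = 0 <-> exists a, i a = x) -> is_lsub S ->
  lsub_gen (i @^-1` S) -> lsub_gen (p @` S) -> lsub_gen S.
Proof.
move=> ex hS [s [sS sP]] [t [tS tP]].
have /choice[g gP] : forall y, exists x, y \in t -> S x /\ p x = y.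
  move=> y; have [/tS[x Sx <-]|_] := boolP (y \in t); first by exists x.
  by exists 0.
exists (map i s ++ map g t); split=> [y|D hD sD x Sx].
  by rewrite mem_cat => /orP[] /mapP[z zs ->]; [exact: sS | exact: (gP _ zs).1].
(* The image of D meets p S in enough points already when D is replaced by its intersection with S;
   this keeps x - d in S, so that its preimage in A lies in the part generated by s. *)
have [d [Dd Sd pd]] : exists d, [/\ D d, S d & p d = p x].
  have hDS : is_lsub (D `&` S).
    split; first by split; exact: lsub0.
      by move=> u v [? ?] [? ?]; split; exact: lsubB.
    by move=> r u [? ?]; split; exact: lsubZ.
  have [||d [Dd Sd] pd] := tP _ (image_is_lsub p hDS) _ (p x).
  - move=> y yt; have [Sg pg] := gP _ yt; exists (g y) => //; split=> //.
    by apply: sD; rewrite mem_cat map_f ?orbT.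
  - by exists x.
  - by exists d.
have /ex[a aE] : p (x - d) = 0 by rewrite raddfB pd subrr.
rewrite -[x](subrK d); apply: lsubD => //; rewrite -aE.
apply: (sP (i @^-1` D)); first exact: preim_is_lsub.
  by move=> y ys; apply: sD; rewrite mem_cat map_f.
by rewrite /= aE; exact: lsubB.
Qed.

Lemma noetherian_ext (A B C : lmodule R) :
  ses A B C -> noetherian A -> noetherian C -> noetherian B.
Proof.
move=> [i [p [_ _ ex]]] nA nC S hS; apply: (lsub_gen_ext ex) => //.
  exact/nA/preim_is_lsub.
exact/nC/image_is_lsub.
Qed.

Lemma noetherian_quo (A B : lmodule R) (p : lm_hom A B) :
  hom_surj p -> noetherian A -> noetherian B.
Proof.
move=> ps nA S hS; have := lsub_gen_image p (nA _ (preim_is_lsub p hS)).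
rewrite image_preimage //.
by apply/seteqP; split=> // y _; have [x <-] := ps y; exists x.
Qed.

Lemma fin_gen_quo A B (p : lm_hom A B) : hom_surj p -> fin_gen A -> fin_gen B.
Proof.
move=> ps /fin_genP gA; apply/fin_genP; have := lsub_gen_image p gA.
suff -> : p @` [set: A] = [set: B] by [].
by apply/seteqP; split=> // y _; have [x <-] := ps y; exists x.
Qed.

Lemma fin_gen_ext A B C : ses A B C -> fin_gen A -> fin_gen C -> fin_gen B.
Proof.
move=> [i [p [_ ps ex]]] /fin_genP gA /fin_genP gC.
apply/fin_genP/(lsub_gen_ext ex) => //.
suff -> : p @` [set: B] = [set: C] by [].
by apply/seteqP; split=> // y _; have [x <-] := ps y; exists x.
Qed.

Lemma noetherian_sub A B C : ses A B C -> noetherian B -> fin_gen A.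
Proof.
move=> [i [p [inji _ _]]] nB; apply/fin_genP.
have [s [sS sP]] := nB _ (image_is_lsub i (setT_is_lsub A)).
have /choice[g gP] : forall y, exists x, y \in s -> i x = y.
  move=> y; have [/sS[x _ <-]|_] := boolP (y \in s); first by exists x.
  by exists 0.
exists (map g s); split=> // D hD sD x _.
have [||d Dd /inji<-] // := sP _ (image_is_lsub i hD) _ (i x).
  by move=> y ys; exists (g y); [apply/sD/map_f | exact: gP].
Qed.

Definition left_mod (e : R) : umodule R.
Proof.
apply: (@UModule K R (left_ideal e)); apply: unitary_of => x.
have [u uP] := hR [:: (lsub_val x : R)]; exists u.
by apply: val_inj => /=; rewrite uP ?inE.
Defined.

Lemma left_mod_in (e r : R) :
  r ** e \in lsub_pred (left_ideal_is_lsub e : is_lsub (V := reg_lmodule R) _).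
Proof. by apply/asboolP; exists r. Qed.

Lemma left_mod_fix (e : R) (x : left_mod e) :
  e ** e = e -> (lsub_val x : R) ** e = lsub_val x.
Proof. by move=> ee; have /asboolP[r _ <-] := lsubP x; rewrite -numulA ee. Qed.

Definition left_mod_hom (e : R) (V : lmodule R) (x : V) : lm_hom (left_mod e) V.
Proof.
apply: (@mkhom K R (left_mod e) V (fun r => lact (lsub_val r : R) x)).
  by move=> r s /=; rewrite -lactBl.
by move=> r s /=; rewrite -lactA.
Defined.

(** A homomorphism from R e is determined by the image of e. For a lift a of h e, the map r |-> r a
    lifts h because r = r e on R e. *)
Lemma left_mod_proj (e : R) : e ** e = e -> projective (left_mod e).
Proof.
move=> ee A B g h gs.
pose e' : left_mod e := LSub (left_mod_in e e).
have [a aP] := gs (h e'); exists (left_mod_hom e a) => x /=.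
rewrite homZ aP -homZ; congr (h _); apply: val_inj => /=.
by rewrite ee left_mod_fix.
Qed.

Context {I : choiceType} (e : I -> R).

Definition idem_units := forall s : seq R, exists w : seq I,
  forall r, r \in s -> (\sum_(i <- w) e i) ** r = r.

Hypotheses (ee : forall i, e i ** e i = e i) (eU : idem_units)
  (eN : forall i, noetherian (left_mod (e i))).

(** Finite sums of columns take the place of free modules of finite rank. *)
Fixpoint free_mod (l : seq I) : umodule R :=
  if l is i :: l' then dsum (left_mod (e i)) (free_mod l') else zero_mod.

Lemma free_mod_proj l : projective (free_mod l).
Proof.
elim: l => [|i l IH] /=; last by apply: projective_dsum => //; exact: left_mod_proj.
exact: (projective_eq0 (N := zero_mod) zero_lmodule_eq0).
Qed.

Lemma free_mod_noetherian l : noetherian (free_mod l).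
Proof.
elim: l => [|i l IH] /=; last first.
  exact: (noetherian_ext (ses_dsum (left_mod (e i)) (free_mod l)) (@eN i) IH).
move=> S hS; exists [::]; split=> // D hD _ x _.
by rewrite [x]zero_lmodule_eq0; exact: lsub0.
Qed.

Lemma lsub_gen_cover N (s : seq N) :
  exists l (p : lm_hom (free_mod l) N), forall x, x \in s -> exists y, p y = x.
Proof.
(* A generator x is the sum of finitely many e_i x, and each e_i x is the image of e_i under R e_i
   -> N, so the columns are indexed by pairs (i, x). *)
suff H : forall t : seq (I * N), exists l (p : lm_hom (free_mod l) N),
    forall q, q \in t -> exists y, p y = lact (e q.1) q.2.
  have [v vP] := local_unit_act hR s.
  have [w wP] := eU [:: v].
  have [l [p pP]] := H [seq (i, x) | x <- s, i <- w].
  exists l, p => x xs.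
  have xE : x = \sum_(i <- w) lact (e i) x.
    by rewrite -lact_suml -{2}(vP x xs) -lactA wP ?inE ?vP.
  have [y _ yx] : (p @` setT) x.
    rewrite xE; apply: lsub_sum; first exact/image_is_lsub/setT_is_lsub.
    move=> i iw; have [|y yE] := pP (i, x); last by exists y.
    by apply/allpairsP; exists (x, i).
  by exists y.
elim=> [|[i x] t [l [p pP]]]; first by exists [::], (zero_hom _ N).
exists (i :: l), (copair_hom (left_mod_hom (e i) x) p) => q.
rewrite inE => /predU1P[->|/pP[y yE]]; last first.
  by exists (0, y); rewrite /= lact0l add0r.
exists (LSub (left_mod_in (e i) (e i)), 0).
by rewrite /= raddf0 addr0 ee.
Qed.

Lemma fin_gen_cover N : fin_gen N ->
  exists l (p : lm_hom (free_mod l) N), hom_surj p.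
Proof.
move=> /fin_genP[s [_ sP]]; have [l [p pP]] := lsub_gen_cover s.
exists l, p => x.
have [||y _ yx] := sP (p @` setT) _ _ x Logic.I; last by exists y.
  exact/image_is_lsub/setT_is_lsub.
by move=> y /pP[z zy]; exists z.
Qed.

Lemma fin_gen_ses N : fin_gen N ->
  exists l Z, ses Z (free_mod l) N /\ fin_gen Z.
Proof.
move=> /fin_gen_cover[l [p ps]]; have [Z [i [inji ex]]] := kernel_ses hR ps.
have s : ses Z (free_mod l) N by exists i, p.
exists l, Z; split=> //; apply: noetherian_sub s _.
exact: free_mod_noetherian.
Qed.

Lemma fin_gen_noetherian N : fin_gen N -> noetherian N.
Proof.
move=> /fin_gen_cover[l [p ps]]; apply: noetherian_quo ps _.
exact: free_mod_noetherian.
Qed.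

(** Level 0 reaches finite sums of columns by extensions, and then finitely generated projectives by
    splitting a cover. Each further level is one cokernel step along a finitely generated syzygy. *)
Lemma fin_gen_resolution_ind (D : nat -> umodule R -> Prop) :
  (forall A B C, ses A B C -> D 0%N A -> D 0%N C -> D 0%N B) ->
  (forall A B, retract A B -> D 0%N B -> D 0%N A) ->
  D 0%N zero_mod -> (forall i, D 0%N (left_mod (e i))) ->
  (forall k A B C, ses A B C -> D k A -> D 0%N B -> D k.+1 C) ->
  forall k N, fin_gen N -> pdle k N -> D k N.
Proof.
move=> Dext Dret D0 De Dcok.
have Dfree l : D 0%N (free_mod l).
  by elim: l => //= i l; apply: Dext (ses_dsum _ _) _.
elim=> [|k IH] N gN dN.
  have [l [p ps]] := fin_gen_cover gN; apply: (Dret _ (free_mod l)) => //.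
  by have [s sP] := dN _ _ p (id_hom N) ps; exists s, p.
have [l [Z [s gZ]]] := fin_gen_ses gN; apply: (Dcok _ Z (free_mod l)) => //.
by apply: IH => //; apply: pdle_syzygy s _ dN => //; exact: free_mod_proj.
Qed.

End Noetherian.

(** * Finite length over the ground ring *)

Section FiniteLength.
Context {K : comPzRingType}.

Definition noetherianK (V : lmodType K) (A : set V) :=
  forall B : set V, is_submodK B -> B `<=` A -> exists s : seq V,
    (forall y, y \in s -> B y) /\
    forall D, is_submodK D -> (forall y, y \in s -> D y) -> B `<=` D.

(** Generators are collected along the composition series. If B meets C (k+1) outside C k in some b,
    maximality gives C (k+1) = K b + C k, so b is the only new generator needed. *)
Lemma finite_length_noetherianK (V : lmodType K) (A : set V) :
  finite_length A -> noetherianK A.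
Proof.
move=> [n [C [C0 <- CK Cmax]]] B hB BC.
suff {BC} H : forall k, (k <= n)%N -> exists s : seq V,
    (forall y, y \in s -> (B `&` C k) y) /\
    forall D, is_submodK D -> (forall y, y \in s -> D y) -> B `&` C k `<=` D.
  have [s [sB sP]] := H n (leqnn n); exists s; split=> [y /sB[]//|D hD sD y By].
  by apply: (sP D hD sD); split=> //; exact: BC.
have [B0 BD] := hB.
elim=> [|k IH] kn.
  by exists [::]; split=> // D [D0 _] _ y [_]; rewrite C0 => /= ->.
have [s [sB sP]] := IH (ltnW kn).
have [[Ck_sub _] Ck_max] := Cmax _ kn.
have [BCk|/existsNP[b /not_implyP[[Bb Cb] nCb]]] := pselect (B `&` C k.+1 `<=` C k).
  exists s; split=> [y /sB[By /Ck_sub]//|D hD sD y [By Cy]].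
  by apply: (sP D hD sD); split=> //; apply: BCk.
have [[Ck0 CkD] [_ CSD]] := (CK _ (ltnW kn), CK _ kn).
exists (b :: s); split=> [y|D hD sD x [Bx Cx]].
  by rewrite inE => /predU1P[->//|/sB[By /Ck_sub]].
pose E : set V := [set x | exists c (l : K), C k c /\ x = l *: b + c].
have [|||EC|EC] := Ck_max E.
- split; first by exists 0, 0; rewrite scale0r addr0.
  move=> l _ _ [c [m [Cc ->]]] [c' [m' [Cc' ->]]].
  exists (l *: c + c'), (l * m + m'); split; first exact: CkD.
  by rewrite scalerDr scalerA addrACA scalerDl.
- by move=> c Cc; exists c, 0; rewrite scale0r add0r.
- by move=> _ [c [l [/Ck_sub Cc ->]]]; exact: CSD.
- case: nCb; rewrite -EC; exists 0, 1; split=> //.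
  by rewrite scale1r addr0.
move: Cx; rewrite -EC => -[c [l [Cc xE]]].
have cE : c = (- l) *: b + x by rewrite xE addrA -scalerDl addNr scale0r add0r.
rewrite xE; apply: hD.2; first by apply: sD; rewrite inE eqxx.
apply: (sP D hD) => [y ys|]; first by apply: sD; rewrite inE ys orbT.
by split=> //; rewrite cE; exact: BD.
Qed.

Lemma finite_length_submodK (V : lmodType K) (A : set V) :
  finite_length A -> is_submodK A.
Proof. by move=> [n [C [_ <- CK _]]]; exact: CK. Qed.

Lemma noetherianK_image (V W : lmodType K) (f : {linear V -> W}) (A : set V)
    (A' : set W) :
  finite_length A -> A' `<=` f @` A -> noetherianK A'.
Proof.
move=> fA AA' B [B0 BD] BA'.
have [A0 AD] := finite_length_submodK fA.
have [|x []//|s [sB sP]] := finite_length_noetherianK fA (B := A `&` f @^-1` B).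
  split=> [|k x y [Ax Bx] [Ay By]] /=; first by rewrite raddf0.
  by split; [exact: AD | rewrite linearP; exact: BD].
exists (map f s); split=> [_ /mapP[y /sB[_ By] ->]//|D [D0 DD] sD y By].
have [x Ax xy] := AA' _ (BA' _ By); rewrite -xy; apply: (sP (f @^-1` D)).
- by split=> [|k u v Du Dv] /=; rewrite ?raddf0 // linearP; exact: DD.
- by move=> z zs; apply: sD; exact: map_f.
- by split=> //; rewrite /= xy.
Qed.

End FiniteLength.

Lemma numul_suml {K : comPzRingType} (R : nuAlg K) (I : Type) (l : seq I)
    (P : pred I) (F : I -> R) (x : R) :
  (\sum_(i <- l | P i) F i) ** x = \sum_(i <- l | P i) F i ** x.
Proof. exact: (big_morph (fun r => r ** x) (fun r s => numulDl r s x) (nu0mul x)). Qed.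

Lemma numul_sumr {K : comPzRingType} (R : nuAlg K) (I : Type) (l : seq I)
    (P : pred I) (F : I -> R) (x : R) :
  x ** (\sum_(i <- l | P i) F i) = \sum_(i <- l | P i) x ** F i.
Proof. exact: (big_morph (numul x) (numulDr x) (numul0 x)). Qed.

(** * Noetherian columns and units made of idempotents *)

Section LocallyNoetherian.
Context {K : comPzRingType} {R : nuAlg K} (hR : local_units R).
Context {I : choiceType} (e : I -> R).

(** A submodule S of R e_i is the sum of its pieces e_k S. Only finitely many of the e_k R e_i are
    nonzero, and in each the piece e_k S is a K-submodule, hence finitely generated over K. *)
Lemma left_mod_noetherian (i : I) :
  idem_units e -> (forall k, e k ** e k = e k) ->
  finite_set [set k | peirce (e k) (e i) <> [set 0]] ->
  (forall k, noetherianK (peirce (e k) (e i))) ->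
  noetherian (left_mod hR (e i)).
Proof.
move=> eU ee /finite_seqP[w0 w0E] nK S hS.
(* Modules carry no K-action, so K-submodules are formed inside [R] itself. *)
pose im (D : set (left_mod hR (e i))) : set R :=
  [set r : R | exists x, D x /\ lsub_val x = r :> R].
have imK D k : is_lsub D -> is_submodK (im D `&` [set r | e k ** r = r]).
  move=> hD; split.
    by split; [exists 0; split; [exact: lsub0 hD|] | exact: numul0].
  move=> c _ _ [[x [Dx <-]] /= xk] [[y [Dy <-]] /= yk]; split.
    have [u uP] := local_unit1 hR x.
    (* Scaling by c is the action of the ring element c u, where u is a local unit for x. *)
    exists (lact (c *: u) x + y); split.
      by apply: lsubD => //; exact: lsubZ.
    rewrite -[LHS]/(val (lact (c *: u) x + y)) raddfD /=; congr (_ + _).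
    by rewrite numulZl; congr (_ *: _); rewrite -{2}uP.
  by rewrite /= numulDr numulZr xk yk.
have imP k : im S `&` [set r | e k ** r = r] `<=` peirce (e k) (e i).
  move=> _ [[x [Sx <-]] /= xk]; exists (lsub_val x) => //.
  by rewrite xk left_mod_fix.
have /choice[s sP] := fun k => nK k _ (imK S k hS) (@imP k).
have /choice[g gP] : forall r : R, exists x : left_mod hR (e i),
    im S r -> S x /\ lsub_val x = r.
  by move=> r; have [[x xP]|nr] := pselect (im S r); [exists x | exists 0].
exists [seq g r | k <- w0, r <- s k]; split.
  move=> _ /allpairsPdep[k [r [kw rs ->]]]; have [+ _] := sP k.
  by move=> /(_ r rs)[Sr _]; exact: (gP r Sr).1.
move=> D hD gD x Sx; have [w wP] := eU [:: (lsub_val x : R)].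
have -> : x = \sum_(k <- w) lact (e k) x.
  by rewrite -lact_suml; apply: val_inj => /=; rewrite wP ?inE.
apply: lsub_sum => // k _; have [kw|kw] := boolP (k \in w0).
  have [sS sD] := sP k.
  have [||[y [Dy yE]] _] := sD _ (imK D k hD) _ (e k ** lsub_val x).
  - move=> r rs; have [Sr rk] := sS r rs; split=> //.
    exists (g r); split; last exact: (gP r Sr).2.
    by apply: gD; apply/allpairsPdep; exists k, r.
  - split; last by rewrite /= numulA ee.
    by exists (lact (e k) x); split=> //; exact: lsubZ.
  - by rewrite (_ : lact (e k) x = y) //; exact: val_inj.
rewrite (_ : lact (e k) x = 0); first exact: lsub0.
apply: val_inj => /=.
have pk : peirce (e k) (e i) = [set 0].
  apply: contrapT => /= pk.
  have : [set k | peirce (e k) (e i) <> [set 0]] k by [].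
  by rewrite w0E /= (negbTE kw).
have : peirce (e k) (e i) (e k ** lsub_val x).
  by exists (lsub_val x) => //; rewrite -numulA left_mod_fix.
by rewrite pk.
Qed.

Lemma enough_idempotents_units : enough_idempotents e -> idem_units e.
Proof.
move=> [ee eo ed _] s.
(* The list w is the support of r in the decomposition by the e_i R. By orthogonality every larger
   duplicate-free list works as well, which allows the supports of several elements to be merged. *)
have /choice[c cP] : forall r : R, exists w : seq I, forall w', uniq w' ->
    {subset w <= w'} -> (\sum_(i <- w') e i) ** r = r.
  move=> r; have [c [[cE /finite_seqP[w wE] ->] _]] := ed r.
  exists w => w' uw' ww'.
  rewrite (fsbigE w') //; last first.
    move=> i _ iw'; apply: contrapT => ci; have : [set i | c i != 0] i.
      exact/eqP.
    by rewrite wE => /ww'; rewrite (negbTE iw').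
  rewrite numul_sumr big_seq_cond [RHS]big_seq_cond.
  apply: eq_bigr => i /andP[iw' _]; rewrite numul_suml.
  rewrite (bigD1_seq i) //= big1 ?addr0.
    by have [x _ <-] := cE i; rewrite numulA ee.
  by move=> j ji; have [x _ <-] := cE i; rewrite numulA eo // nu0mul.
exists (undup (flatten (map c s))) => r rs; apply: cP; first exact: undup_uniq.
move=> i ic; rewrite mem_undup; apply/flattenP.
by exists (c r) => //; exact: map_f.
Qed.

End LocallyNoetherian.

Lemma idem_units_local {K : comPzRingType} {R : nuAlg K} {I : choiceType}
  (e : I -> R) : idem_units e -> local_units R.
Proof. by move=> eU s; have [w wP] := eU s; exists (\sum_(i <- w) e i). Qed.

(** * Change of rings *)

Section ChangeOfRings.
Context {K : comPzRingType} {S R : nuAlg K} (a : S -> R).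

Definition alg_morphism :=
  (forall x y, a (x + y) = a x + a y) /\ (forall x y, a (x ** y) = a x ** a y).

Context (ha : alg_morphism).

Definition restr (V : lmodule R) : lmodule S.
Proof.
apply: (@LModule K S V (fun s x => lact (a s) x)) => [r s x|r x y|r s x].
- by rewrite ha.1 lactDl.
- by rewrite lactDr.
- by rewrite ha.2 lactA.
Defined.

Definition restr_hom (V W : lmodule R) (f : lm_hom V W) : lm_hom (restr V) (restr W).
Proof.
apply: (@mkhom K S (restr V) (restr W) f) => [|r x]; first exact: raddfB.
exact: (homZ f (a r) x).
Defined.

Lemma restr_ses (A B C : lmodule R) :
  ses A B C -> ses (restr A) (restr B) (restr C).
Proof. by move=> [i [p h]]; exists (restr_hom i), (restr_hom p). Qed.

Context (hS : local_units S).

(** This set is a(S) V: every a(r) x is fixed by a local unit of r, whatever x is. *)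
Lemma corner_is_lsub (V : lmodule R) :
  is_lsub ([set x | exists s, lact (a s) x = x] : set (restr V)).
Proof.
have [aD aM] := ha; split=> /=.
- by exists 0; rewrite lact0r.
- move=> x y [s sx] [t ty]; have [u uP] := hS [:: s; t].
  exists u; rewrite lactBr -{1}sx -{1}ty -!lactA -!aM !uP ?sx ?ty //.
    by rewrite !inE eqxx orbT.
  by rewrite inE eqxx.
- move=> r x _; have [u uP] := hS [:: r].
  by exists u; rewrite -lactA -aM uP ?inE.
Qed.

(* The restriction of V along a is in general not unitary; this is its largest
   unitary submodule. *)
Definition corner (V : lmodule R) : umodule S.
Proof.
apply: (@UModule K S (lsub (corner_is_lsub V))); apply: unitary_of => x.
have /asboolP[s sx] := lsubP x; exists s; exact: val_inj.
Defined.

Definition corner_val (V : lmodule R) : lm_hom (corner V) (restr V).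
Proof.
by apply: (@mkhom K S (corner V) (restr V) (@lsub_val K S _ _ (corner_is_lsub V))).
Defined.

Lemma corner_val_inj (V : lmodule R) : injective (@corner_val V).
Proof. exact: val_inj. Qed.

Lemma cornerP (V : lmodule R) (x : V) :
  (exists s, lact (a s) x = x) <-> exists y, corner_val V y = x.
Proof.
split=> [xs|[y <-]]; last by have /asboolP := @lsubP K S _ _ (corner_is_lsub V) y.
have xV : x \in lsub_pred (corner_is_lsub V) by apply/asboolP.
by exists (@LSub K S (restr V) _ (corner_is_lsub V) x xV).
Qed.

Lemma corner_hom (V W : lmodule R) (f : lm_hom V W) :
  exists g : lm_hom (corner V) (corner W),
    forall x, corner_val W (g x) = f (corner_val V x).
Proof.
apply: (hom_factor (h := comp_hom (restr_hom f) (corner_val V))).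
  exact: corner_val_inj.
move=> x; apply/cornerP.
have [_ /(_ (ex_intro _ x erefl))[s sx]] := cornerP (corner_val V x).
by exists s; rewrite -homZ; congr (f _).
Qed.

(** A preimage x of y need not lie in the corner, but if a(s) fixes y then a(s) x lies there and is
    a preimage too. *)
Lemma corner_hom_surj (V W : lmodule R) (f : lm_hom V W)
    (g : lm_hom (corner V) (corner W)) :
  (forall x, corner_val W (g x) = f (corner_val V x)) -> hom_surj f -> hom_surj g.
Proof.
move=> gP fs y.
have /cornerP[s sy] : exists z, corner_val W z = corner_val W y by exists y.
have [x xE] := fs (corner_val W y); have [u uP] := hS [:: s].
have /cornerP[z zE] : exists t, lact (a t) (lact (a s) x) = lact (a s) x.
  by exists u; rewrite -lactA -ha.2 uP ?inE.
exists z; apply: corner_val_inj; rewrite gP zE homZ xE; exact: sy.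
Qed.

Lemma corner_ses (A B C : lmodule R) :
  ses A B C -> ses (corner A) (corner B) (corner C).
Proof.
move=> [i [p [inji ps ex]]].
have [j jP] := corner_hom i; have [q qP] := corner_hom p.
exists j, q; split; last 1 first.
- move=> x; split=> [qx0|[z <-]]; last first.
    apply: corner_val_inj; rewrite qP jP raddf0.
    by apply/ex; exists (corner_val A z).
  have /ex[y yE] : p (corner_val B x) = 0 by rewrite -qP qx0 raddf0.
  have /cornerP[s sx] : exists z, corner_val B z = corner_val B x by exists x.
  (* The element s that fixes i y also fixes y, by injectivity of i. *)
  have /cornerP[z zE] : exists t, lact (a t) y = y.
    by exists s; apply: inji; rewrite homZ yE.
  by exists z; apply: corner_val_inj; rewrite jP zE.
- by move=> x y /(congr1 (corner_val B)); rewrite !jP => /inji/corner_val_inj.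
- exact: corner_hom_surj ps.
Qed.

End ChangeOfRings.

(** * Inflation along a surjective morphism *)

Section Inflation.
Context {K : comPzRingType} {R S : nuAlg K} (a : R -> S) (ha : alg_morphism a).
Context (hS : local_units S) (asurj : forall s, exists r, a r = s).

Definition infl (V : umodule S) : umodule R.
Proof.
apply: (@UModule K R (restr ha V)); apply: unitary_of => x.
have [s sx] := local_unit1 hS x; have [r rE] := asurj s.
by exists r; rewrite /= rE.
Defined.

Lemma infl_ses (A B C : umodule S) :
  ses A B C -> ses (infl A) (infl B) (infl C).
Proof. exact: restr_ses. Qed.

Lemma infl_retract (A B : umodule S) : retract A B -> retract (infl A) (infl B).
Proof. by move=> [i [p h]]; exists (restr_hom ha i), (restr_hom ha p). Qed.

Definition deflate_hom (V W : lmodule S) (f : lm_hom (restr ha V) (restr ha W)) :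
  lm_hom V W.
Proof.
apply: (@mkhom K S V W f) => [|s x]; first exact: raddfB.
by have [r <-] := asurj s; exact: homZ f r x.
Defined.

Lemma infl_is_lsub (V : lmodule S) (D : set V) :
  is_lsub (V := restr ha V) D <-> is_lsub D.
Proof.
split=> -[D0 DB DZ]; split=> // r x Dx; last exact: DZ.
by have [s <-] := asurj r; exact: DZ.
Qed.

Lemma lsub_gen_infl (V : lmodule S) (D : set V) :
  lsub_gen (V := restr ha V) D <-> lsub_gen D.
Proof.
split=> -[s [sD sP]]; exists s; split=> // E /infl_is_lsub hE; exact: sP.
Qed.

Lemma fin_gen_infl (hR : local_units R) (V : umodule S) :
  fin_gen (infl V) <-> fin_gen V.
Proof.
split=> [/(fin_genP hR) g|/(fin_genP hS) g].
  exact/(fin_genP hS)/lsub_gen_infl.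
exact/(fin_genP hR)/lsub_gen_infl.
Qed.

End Inflation.

(** * Modules over a triangular algebra *)

Section Triangular.
Context {K : comPzRingType} {U T : nuAlg K} (M : bimodule U T).
Context (hU : local_units U) (hT : local_units T).
Local Notation L := (tri_alg M).
Context (hL : local_units L).

Definition inU (u : U) : L := (0, 0, u).
Definition inT (t : T) : L := (t, 0, 0).
Definition prU (l : L) : U := l.2.
Definition prT (l : L) : T := l.1.1.

Lemma inU_morph : alg_morphism inU.
Proof.
split=> x y; first by rewrite /inU; congr (_, _, _); rewrite addr0.
by rewrite /inU; congr (_, _, _); rewrite /= ?numul0 ?bir0l ?bil0r ?addr0.
Qed.
Lemma inT_morph : alg_morphism inT.
Proof.
split=> x y; first by rewrite /inT; congr (_, _, _); rewrite addr0.
by rewrite /inT; congr (_, _, _); rewrite /= ?numul0 ?bir0l ?bil0r ?addr0.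
Qed.
Lemma prU_morph : alg_morphism prU. Proof. by []. Qed.
Lemma prT_morph : alg_morphism prT. Proof. by []. Qed.
Lemma prU_surj u : exists l, prU l = u. Proof. by exists (inU u). Qed.
Lemma prT_surj t : exists l, prT l = t. Proof. by exists (inT t). Qed.

(** This and [inT_mul] hold the asymmetry of the triangular shape: the U-corner of a module is
    stable under all of L, while the T-corner is only a quotient. *)
Lemma mul_inU (l : L) u : l ** inU u = inU (prU l ** u).
Proof. by congr (_, _, _); rewrite /= ?numul0 ?bir0r ?bil0r ?addr0. Qed.
Lemma inT_mul (l : L) t : inT t ** l = inT (t ** prT l).
Proof. by congr (_, _, _); rewrite /= ?nu0mul ?bir0l ?bil0l ?addr0. Qed.

Notation iU := (infl prU_morph hU prU_surj).
Notation iT := (infl prT_morph hT prT_surj).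
Notation FU := (corner inU_morph hU).
Notation FT := (corner inT_morph hT).
Notation valU := (corner_val inU_morph hU).
Notation valT := (corner_val inT_morph hT).

Lemma inU_act (V : umodule L) (x : FU V) :
  exists u, lact (inU u) (valU V x) = valU V x.
Proof. by have [_] := cornerP inU_morph hU (valU V x); apply; exists x. Qed.
Lemma inT_act (V : umodule L) (x : FT V) :
  exists t, lact (inT t) (valT V x) = valT V x.
Proof. by have [_] := cornerP inT_morph hT (valT V x); apply; exists x. Qed.

Lemma act_inU (V : lmodule L) (l : L) u (x : V) :
  lact (inU u) x = x -> lact l x = lact (inU (prU l)) x.
Proof. by move=> <-; rewrite -!lactA !mul_inU. Qed.

Lemma act_cornerU (V : umodule L) (l : L) (x : FU V) :
  lact l (valU V x : V) = valU V (lact (prU l) x).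
Proof. by have [u ux] := inU_act x; rewrite homZ; exact: act_inU ux. Qed.

Definition cornerU_hom (V : umodule L) : lm_hom (iU (FU V)) V.
Proof.
apply: (@mkhom K L (iU (FU V)) V (valU V)) => [|l x]; first exact: raddfB.
by rewrite act_cornerU.
Defined.

(** What remains of l lies in the bottom row (m, u), and an element of U can act as a left unit on m
    and u at once. *)
Lemma tri_unitU (l : L) : exists u, inU u ** (l - inT (prT l)) = l - inT (prT l).
Proof.
case: l => -[t m] v; have [s mE] := bil_unitary m.
have [u uP] := hU (v :: map fst s); exists u.
congr (_, _, _) => /=; rewrite /prT /= ?subrr ?subr0 ?nu0mul ?uP ?inE ?eqxx //.
rewrite bir0r add0r mE (big_morph (bil u) (bilDr (b:=M) u) (bil0r M u)).
by apply: eq_big_seq => p ps; rewrite -bilA uP // inE map_f ?orbT.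
Qed.

(** As a group V is the direct sum of its two corners: [tri_unitU] gives the decomposition, and the
    product of [inT t] and [inU u] is 0, so the sum is direct. The projection to the T-corner is
    L-linear because its kernel, the U-corner, is a submodule. *)
Lemma cornerT_proj (V : umodule L) : exists p : lm_hom V (iT (FT V)),
  (forall y, p (valT V y) = y) /\
  (forall x, p x = 0 <-> exists a, cornerU_hom V a = x).
Proof.
have UT0 a b : cornerU_hom V a = valT V b -> b = 0.
  move=> ab; have [u uE] := inU_act a; have [t tE] := inT_act b.
  have uE' : lact (inU u) (valT V b : V) = valT V b by rewrite -ab.
  have tE' : lact (inT t) (valT V b : V) = valT V b by [].
  apply: corner_val_inj; rewrite raddf0.
  have : lact (inT t) (lact (inU u) (valT V b : V)) = valT V b by rewrite uE'.
  by rewrite -lactA inT_mul /prT /= numul0 lact0l => <-.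
have /choice[p pP] : forall x : V, exists y a,
    x = valT V y + cornerU_hom V a.
  move=> x; have [l lx] := local_unit1 hL x.
  have /(cornerP inT_morph hT)[y yE] : exists t,
      lact (inT t) (lact (inT (prT l)) x) = lact (inT (prT l)) x.
    by have [t tP] := hT [:: prT l]; exists t; rewrite -lactA -inT_morph.2 tP ?inE.
  have /(cornerP inU_morph hU)[a aE] : exists u,
      lact (inU u) (lact (l - inT (prT l)) x) = lact (l - inT (prT l)) x.
    by have [u uE] := tri_unitU l; exists u; rewrite -lactA uE.
  have aE' : cornerU_hom V a = lact (l - inT (prT l)) x by exact: aE.
  by exists y, a; rewrite yE aE' lactBl lx addrC subrK.
have puniq x y a : x = valT V y + cornerU_hom V a -> p x = y.
  move=> xE; have [a' xE'] := pP x; apply/eqP; rewrite -subr_eq0; apply/eqP.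
  apply: (UT0 (a - a')); rewrite !raddfB.
  apply/eqP; rewrite subr_eq addrAC eq_sym subr_eq eq_sym; apply/eqP.
  by rewrite -xE' xE addrC.
have pB : zmod_morphism p.
  move=> x y; have [a xE] := pP x; have [b yE] := pP y.
  apply: (puniq _ _ (a - b)); rewrite {1}xE {1}yE !raddfB /=.
  by rewrite opprD addrACA.
have pZ l x : p (lact l x) = lact l (p x : iT (FT V)).
  have [a xE] := pP x; have [t tE] := inT_act (p x).
  have /(cornerP inU_morph hU)[b bE] : exists u,
      lact (inU u) (lact (l - inT (prT l)) (valT V (p x) : V))
      = lact (l - inT (prT l)) (valT V (p x) : V).
    by have [u uE] := tri_unitU l; exists u; rewrite -lactA uE.
  have bE' : cornerU_hom V b = lact (l - inT (prT l)) (valT V (p x) : V).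
    exact: bE.
  have e1 : valT V (lact l (p x : iT (FT V))) =
      lact (inT (prT l)) (valT V (p x) : V).
    exact: (homZ (valT V) (prT l) (p x)).
  have e2 : cornerU_hom V (lact l a) = lact l (cornerU_hom V a) by exact: homZ.
  apply: (puniq _ _ (b + lact l a)).
  rewrite {1}xE lactDr e1 raddfD e2 bE' addrA; congr (_ + _).
  by rewrite lactBl addrC subrK.
exists (@mkhom K L V (iT (FT V)) p pB pZ); split=> [y|x] /=.
  by apply: (puniq _ _ 0); rewrite raddf0 addr0.
split=> [px0|[a <-]]; last by apply: (puniq _ _ a); rewrite raddf0 add0r.
have [a xE] := pP x; exists a.
by rewrite [RHS]xE px0 raddf0 add0r.
Qed.

Lemma corner_tri_ses (V : umodule L) : ses (iU (FU V)) V (iT (FT V)).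
Proof.
have [p [pv pk]] := cornerT_proj V; exists (cornerU_hom V), p; split=> //.
  exact: corner_val_inj.
by move=> y; exists (valT V y).
Qed.

(** Inflation from U is left adjoint to the U-corner: a map from [iU P] to B has its image in the
    U-corner of B. The U-corner preserves surjections, so its left adjoint preserves projectives. *)
Lemma inflU_projective (P : umodule U) : projective P -> projective (iU P).
Proof.
move=> pP A B g h gs.
have [k kP] : exists k : lm_hom P (FU B), forall x, cornerU_hom B (k x) = h x.
  have [k kP] : exists k : lm_hom (iU P) (iU (FU B)),
      forall x, cornerU_hom B (k x) = h x.
    apply: hom_factor; first exact: corner_val_inj.
    move=> x; apply/(cornerP inU_morph hU); have [u ux] := local_unit1 hU x.
    by exists u; rewrite -homZ /= /prU /= ux.
  by exists (deflate_hom prU_surj k).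
have [f fP] := corner_hom inU_morph hU g.
have [m mP] := pP _ _ f k (corner_hom_surj fP gs).
exists (comp_hom (cornerU_hom A) (restr_hom prU_morph m)) => x /=.
by rewrite -kP -mP; have := fP (m x) => /= ->.
Qed.

Lemma inflU_pdle n (N : umodule U) : pdle n N -> pdle n (iU N).
Proof.
elim: n N => [|n IH] N; first exact: inflU_projective.
move=> [P [Z [pP s dZ]]]; exists (iU P), (iU Z); split.
- exact: inflU_projective.
- exact: restr_ses.
- exact: IH.
Qed.

(** The T-corner is left adjoint to the exact inflation from T: maps from [FT P] to A correspond to
    maps from P to [iT A] through the projection p. *)
Lemma cornerT_projective (P : umodule L) : projective P -> projective (FT P).
Proof.
move=> pP A B g h gs; have [p [pv _]] := cornerT_proj P.
have [k kP] := pP (iT A) (iT B) (restr_hom prT_morph g)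
  (comp_hom (restr_hom prT_morph h) p) gs.
have [m mP] : exists m : lm_hom (FT P) A, forall x, m x = k (valT P x).
  have mZ t x : k (valT P (lact t x)) = lact t (k (valT P x) : A).
    by rewrite homZ; exact: (homZ k (inT t) (valT P x)).
  have mB : zmod_morphism (fun x => k (valT P x) : A) by move=> x y; rewrite !raddfB.
  by exists (@mkhom K T (FT P) A (fun x => k (valT P x)) mB mZ).
exists m => x; rewrite mP; have /= -> := kP (valT P x).
by rewrite pv.
Qed.

Lemma cornerT_pdle n (N : umodule L) : pdle n N -> pdle n (FT N).
Proof.
elim: n N => [|n IH] N; first exact: cornerT_projective.
move=> [P [Z [pP s dZ]]]; exists (FT P), (FT Z); split.
- exact: cornerT_projective.
- exact: corner_ses.
- exact: IH.
Qed.

Lemma inflU_projectiveK (P : umodule U) : projective (iU P) -> projective P.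
Proof.
move=> pP A B g h gs.
have [k kP] := pP (iU A) (iU B) (restr_hom prU_morph g) (restr_hom prU_morph h) gs.
by exists (deflate_hom prU_surj k).
Qed.

(** T kills [iU X], so p is injective on the T-corner of V; local units of T make it surjective
    there. *)
Lemma cornerT_ext (X : umodule U) (V : umodule L) (Y : umodule T) :
  ses (iU X) V (iT Y) -> retract Y (FT V).
Proof.
move=> [i [p [inji ps ex]]].
have [q qP] : exists q : lm_hom (FT V) Y, forall x, q x = p (valT V x).
  have qZ t x : p (valT V (lact t x)) = lact t (p (valT V x) : Y).
    by rewrite homZ; exact: (homZ p (inT t) (valT V x)).
  have qB : zmod_morphism (fun x => p (valT V x) : Y) by move=> x y; rewrite !raddfB.
  by exists (@mkhom K T (FT V) Y (fun x => p (valT V x)) qB qZ).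
suff [qi qs] : injective q /\ hom_surj q by exact: (bij_retract qi qs).2.
split.
  apply: hom_inj0 => x; rewrite qP => /ex[z zE]; apply: corner_val_inj.
  have [t tx] := inT_act x; rewrite raddf0 -tx -zE.
  have := homZ i (inT t) z; rewrite /= /prU /= lact0l raddf0 => ->.
  by [].
move=> y; have [x xE] := ps y; have [t ty] := local_unit1 hT y.
have /(cornerP inT_morph hT)[z zE] : exists s,
    lact (inT s) (lact (inT t) x) = lact (inT t) x.
  by have [s sP] := hT [:: t]; exists s; rewrite -lactA -inT_morph.2 sP ?inE.
by exists z; rewrite qP zE homZ xE.
Qed.

End Triangular.

(** * Idempotents of a triangular algebra *)

Section TriangularIdempotents.
Context {K : comPzRingType} {I J : choiceType}.
Context {U : nuAlg K} (e : I -> U) {T : nuAlg K} (f : J -> T).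
Context (M : bimodule U T).
Local Notation L := (tri_alg M).
Local Notation g := (tri_idem M e f).

Lemma inU_linear : linear (@inU K U T M).
Proof.
move=> k x y; rewrite /inU; congr (_, _, _) => /=; by rewrite ?scaler0 ?addr0.
Qed.
HB.instance Definition _ := GRing.isLinear.Build K U L _ (@inU K U T M) inU_linear.

Lemma inT_linear : linear (@inT K U T M).
Proof.
move=> k x y; rewrite /inT; congr (_, _, _) => /=; by rewrite ?scaler0 ?addr0.
Qed.
HB.instance Definition _ := GRing.isLinear.Build K T L _ (@inT K U T M) inT_linear.

Definition inM (m : M) : L := (0, m, 0).
Lemma inM_linear : linear inM.
Proof.
move=> k x y; rewrite /inM; congr (_, _, _) => /=; by rewrite ?scaler0 ?addr0.
Qed.
HB.instance Definition _ := GRing.isLinear.Build K M L _ inM inM_linear.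

Lemma tri_idem_units : idem_units e -> idem_units f -> idem_units g.
Proof.
move=> eU fU s; have [wT wTP] := fU [seq r.1.1 | r <- s].
(* For each m, the finitely many coefficients of U in an expression of m: a unit for these also
   fixes m. *)
have /choice[c cP] : forall m : M, exists t : seq U, forall u,
    (forall v, v \in t -> u ** v = v) -> bil u m = m.
  move=> m; have [t mE] := bil_unitary m; exists (map fst t) => u uP.
  rewrite mE (big_morph (bil u) (bilDr (b:=M) u) (bil0r M u)).
  by apply: eq_big_seq => p pt; rewrite -bilA uP // map_f.
have [wU wUP] := eU ([seq r.2 | r <- s] ++ flatten [seq c r.1.2 | r <- s]).
exists (map inl wU ++ map inr wT) => r rs.
have -> : \sum_(i <- map inl wU ++ map inr wT) g i =
    inU M (\sum_(i <- wU) e i) + inT M (\sum_(j <- wT) f j).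
  by rewrite big_cat !big_map /= !raddf_sum.
have rc : bil (\sum_(i <- wU) e i) r.1.2 = r.1.2.
  apply: cP => v vc; apply: wUP; rewrite mem_cat; apply/orP; right.
  by apply/flattenP; exists (c r.1.2) => //; apply: map_f.
have rT : (\sum_(j <- wT) f j) ** r.1.1 = r.1.1.
  by apply: wTP; exact: (map_f (fun r : L => r.1.1)).
have rU : (\sum_(i <- wU) e i) ** r.2 = r.2.
  by apply: wUP; rewrite mem_cat (map_f (fun r : L => r.2)).
move: r rs rc rT rU => [[t m] u] _ /= rc rT rU.
by congr (_, _, _) => /=; rewrite ?add0r ?addr0 ?bir0l ?add0r.
Qed.

Lemma tri_idem_idem : (forall i, e i ** e i = e i) -> (forall j, f j ** f j = f j) ->
  forall r, g r ** g r = g r.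
Proof.
move=> ee ff [i|j].
  by rewrite -[RHS](congr1 (inU M) (ee i)) (inU_morph M).2.
by rewrite -[RHS](congr1 (inT M) (ff j)) (inT_morph M).2.
Qed.

Lemma tri_peirce_noetherian :
  (forall i k, finite_length (peirce (e k) (e i))) ->
  (forall i k, finite_length (peirce (f k) (f i))) ->
  (forall i j, finite_length (bi_peirce M (e i) (f j))) ->
  forall r s, noetherianK (peirce (g s) (g r)).
Proof.
move=> eL fL mL [i|j] [k|l].
- apply: (noetherianK_image (f := inU M) (eL i k)) => _ [[[t m] u] _ <-].
  exists (e k ** u ** e i); first by exists u.
  by congr (_, _, _); rewrite /= ?nu0mul ?numul0 ?bir0r ?bil0r ?addr0.
(* This is the zero corner of the matrix algebra, so any set of finite length can dominate it. *)
- apply: (noetherianK_image (f := inU M) (eL i i)) => _ [[[t m] u] _ <-].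
  exists 0; first by exists 0; rewrite ?numul0 ?nu0mul.
  by congr (_, _, _); rewrite /= ?nu0mul ?numul0 ?bir0r ?bil0r ?bil0l ?addr0.
- apply: (noetherianK_image (f := inM) (mL k j)) => _ [[[t m] u] _ <-].
  exists (bir (bil (e k) m) (f j)); first by exists m.
  by congr (_, _, _); rewrite /= ?nu0mul ?numul0 ?bir0l ?bil0r ?bil0l ?addr0 ?add0r.
- apply: (noetherianK_image (f := inT M) (fL j l)) => _ [[[t m] u] _ <-].
  exists (f l ** t ** f j); first by exists t.
  by congr (_, _, _); rewrite /= ?nu0mul ?numul0 ?bir0l ?bil0r ?bil0l ?addr0 ?bir0l.
Qed.

Lemma tri_supportU i : finite_set [set r | peirce (g r) (g (inl i)) <> [set 0]] ->
  finite_set [set k | peirce (e k) (e i) <> [set 0]].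
Proof.
move=> fin; apply: (@sub_finite_set _ _ (inl @^-1` _)); last first.
  by apply: finite_preimage fin; move=> x y _ _ [].
move=> k /= nz kz; apply: nz; apply/seteqP; split=> [_ [u _ <-]|_ ->] /=; last first.
  by exists 0; rewrite ?numul0 ?nu0mul.
have : peirce (g (inl k)) (g (inl i)) (inU M (e k ** u ** e i)).
  by exists (inU M u); rewrite // !(inU_morph M).2.
by rewrite kz => -[].
Qed.

Lemma tri_supportT j : finite_set [set r | peirce (g r) (g (inr j)) <> [set 0]] ->
  finite_set [set k | peirce (f k) (f j) <> [set 0]].
Proof.
move=> fin; apply: (@sub_finite_set _ _ (inr @^-1` _)); last first.
  by apply: finite_preimage fin; move=> x y _ _ [].
move=> k /= nz kz; apply: nz; apply/seteqP; split=> [_ [u _ <-]|_ ->] /=; last first.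
  by exists 0; rewrite ?numul0 ?nu0mul.
have : peirce (g (inr k)) (g (inr j)) (inT M (f k ** u ** f j)).
  by exists (inT M u); rewrite // !(inT_morph M).2.
by rewrite kz => -[].
Qed.

End TriangularIdempotents.

(** * Dimensions over the triangular algebra and over its diagonal entries *)

Section Main.
Context {K : comPzRingType} {I J : choiceType}.
Context {U : nuAlg K} (e : I -> U) {T : nuAlg K} (f : J -> T).
Context (M : bimodule U T).
Local Notation L := (tri_alg M).
Local Notation g := (tri_idem M e f).
Context (hU : local_units U) (hT : local_units T) (hL : local_units L).
Context (ee : forall i, e i ** e i = e i) (ff : forall j, f j ** f j = f j).
Context (gg : forall r, g r ** g r = g r).
Context (eU : idem_units e) (fU : idem_units f) (gU : idem_units g).
Context (eN : forall i, noetherian (left_mod hU (e i))).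
Context (fN : forall j, noetherian (left_mod hT (f j))).
Context (gN : forall r, noetherian (left_mod hL (g r))).

Notation iU := (infl (prU_morph M) hU (@prU_surj K U T M)).
Notation iT := (infl (prT_morph M) hT (@prT_surj K U T M)).
Notation FU := (corner (inU_morph M) hU).
Notation FT := (corner (inT_morph M) hT).

(** A finite sum of columns of U stays projective over L, so a syzygy over U is also a syzygy over
    L, and the dimension drops by one on both sides. *)
Lemma inflU_pdleK n (X : umodule U) : fin_gen X -> pdle n (iU X) -> pdle n X.
Proof.
elim: n X => [|n IH] X gX; first exact: inflU_projectiveK.
move=> dX; have [l [Z [s gZ]]] := fin_gen_ses ee eU eN gX.
have pF : projective (free_mod hU e l) by exact: free_mod_proj.
exists (free_mod hU e l), Z; split=> //; apply: IH gZ _.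
apply: (@pdle_syzygy _ _ hL n _ (iU (free_mod hU e l)) (iU X)) => //.
  exact: restr_ses.
exact: inflU_projective.
Qed.

(** The column of a matrix at f_j has the entries t f_j and m f_j. Its middle term is projective
    over L, and this is the source of the summand 1 + m. *)
Lemma column_ses j :
  ses (iU (bi_col M (f j))) (left_mod hL (g (inr j))) (iT (left_mod hT (f j))).
Proof.
have memP (x : left_mod hL (g (inr j))) :
    exists t m, lsub_val x = (t ** f j, bir m (f j), 0) :> L.
  have /asboolP[[[t m] u] _ <-] := lsubP x; exists t, m.
  by congr (_, _, _); rewrite /= ?numul0 ?bil0r ?addr0.
have memL t m : ((t ** f j, bir m (f j), 0) : L) \in
    lsub_pred (left_ideal_is_lsub (g (inr j)) : is_lsub (V := reg_lmodule L) _).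
  apply/asboolP; exists ((t, m, 0) : L) => //.
  by congr (_, _, _); rewrite /= ?nu0mul ?bil0l ?addr0.
have memM (y : bi_col M (f j)) : ((0, lsub_val y, 0) : L) \in
    lsub_pred (left_ideal_is_lsub (g (inr j)) : is_lsub (V := reg_lmodule L) _).
  by have /asboolP[m _ <-] := lsubP y; rewrite -(nu0mul (f j)); exact: memL.
have memT (x : left_mod hL (g (inr j))) : prT (lsub_val x : L) \in
    lsub_pred (left_ideal_is_lsub (f j) : is_lsub (V := reg_lmodule T) _).
  by apply/asboolP; have [t [m ->]] := memP x; exists t.
pose i (y : iU (bi_col M (f j))) : left_mod hL (g (inr j)) := LSub (memM y).
pose p (x : left_mod hL (g (inr j))) : iT (left_mod hT (f j)) := LSub (memT x).
have iB : zmod_morphism i.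
  move=> x y; apply: val_inj; rewrite [RHS]raddfB /=.
  by congr (_, _, _); rewrite /= subr0.
have iZ r x : i (lact r x) = lact r (i x).
  by apply: val_inj; congr (_, _, _); rewrite /= ?numul0 ?bir0r ?add0r.
have pB : zmod_morphism p by move=> x y; exact: val_inj.
have pZ r x : p (lact r x) = lact r (p x) by exact: val_inj.
exists (mkhom iB iZ), (mkhom pB pZ); split=> /=.
- by move=> x y [xy]; exact: val_inj.
- move=> y; have /asboolP[t _ tE] := lsubP y.
  have := memL t 0; rewrite bir0l => h; exists (LSub h).
  exact: val_inj.
- move=> x; split=> [[px0]|[y <-]]; last exact: val_inj.
  have [t [m xE]] := memP x; move: px0; rewrite xE /prT /= => tf0.
  have mf : bir m (f j) \in lsub_pred (bi_col_is_lsub M (f j)).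
    by apply/asboolP; exists m.
  by exists (LSub mf); apply: val_inj; rewrite /= xE tf0.
Qed.

Local Notation sT := (infl_ses (prT_morph M) hT (@prT_surj K U T M)).
Local Notation rT := (infl_retract (prT_morph M) hT (@prT_surj K U T M)).

Lemma inflT_pdle m : (forall j, pdle m (bi_col M (f j))) ->
  forall k Y, fin_gen Y -> pdle k Y -> pdle (k + m.+1) (iT Y).
Proof.
move=> mM; pose D k (Y : umodule T) := pdle (k + m.+1) (iT Y).
apply: (fin_gen_resolution_ind ff fU fN (D := D)); rewrite /D.
- by move=> A B C s; exact: (pdle_ext hL (sT s)).
- by move=> A B r; exact: (pdle_retract hL (rT r)).
- by apply/projective_pdle/projective_eq0; exact: zero_lmodule_eq0.
(* The first passage to a cokernel raises m to m + 1, which is the value at level 0. *)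
- move=> j; apply: (pdle_coker hL (column_ses j)); first exact: inflU_pdle.
  exact/projective_pdle/left_mod_proj.
- move=> k A B C s dA dB; apply: (pdle_coker hL (sT s)) => //.
  by apply: pdle_mono dB; exact: leq_trans (leq_addl k m.+1) (leqnSn _).
Qed.

(** The induction of [inflT_pdle] with the level forgotten: each finitely generated Y involves only
    finitely many columns, so finiteness column by column is enough. *)
Lemma inflT_finpd : (forall j, finpd (bi_col M (f j))) ->
  forall Y, fin_gen Y -> finpd Y -> finpd (iT Y).
Proof.
move=> mM Y gY [k dY]; pose D (k : nat) (Y : umodule T) := finpd (iT Y).
move: k Y gY dY; apply: (fin_gen_resolution_ind ff fU fN (D := D)); rewrite /D.
- by move=> A B C s; have [] := finpd_ses hL (sT s).
- by move=> A B r; exact: (finpd_retract hL (rT r)).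
- by exists 0%N; apply: projective_eq0; exact: zero_lmodule_eq0.
- move=> j; have [_ + _] := finpd_ses hL (column_ses j); apply.
    by have [n dn] := mM j; exists n; exact: inflU_pdle.
  by exists 0%N; apply: left_mod_proj.
- by move=> k A B C s; have [] := finpd_ses hL (sT s).
Qed.

Lemma tri_fin_gen (X : umodule U) (V : umodule L) (Y : umodule T) :
  ses (iU X) V (iT Y) -> fin_gen V <-> fin_gen Y /\ fin_gen X.
Proof.
move=> s; have giU := fin_gen_infl (prU_morph M) hU (@prU_surj K U T M) hL X.
have giT := fin_gen_infl (prT_morph M) hT (@prT_surj K U T M) hL Y.
split=> [gV|[/giT gY /giU gX]]; last exact: fin_gen_ext s gX gY.
split; last by apply/giU/(noetherian_sub hL s)/(fin_gen_noetherian gg gU gN).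
by apply/giT; have [_ [p [_ ps _]]] := s; exact: fin_gen_quo ps gV.
Qed.

Lemma tri_fin_pd (X : umodule U) (V : umodule L) (Y : umodule T) :
  (forall j, finpd (bi_col M (f j))) -> ses (iU X) V (iT Y) -> 
  fin_gen V /\ finpd V <-> (fin_gen Y /\ finpd Y) /\ (fin_gen X /\ finpd X).
Proof.
move=> mM s; have gE := tri_fin_gen s; have [dV _ dX] := finpd_ses hL s.
split=> [[/gE[gY gX] fV]|[[gY fY] [gX [n dn]]]]; last first.
  split; first exact/gE.
  by apply: dV; [exists n; exact: inflU_pdle | exact: inflT_finpd].
(* Y is treated before X: the T-corner of V bounds it directly, and only then does the exact
   sequence make [iU X] of finite dimension. *)
have fY : finpd Y.
  have [n dn] := fV; exists n; apply: (pdle_retract hT (cornerT_ext s)).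
  exact: cornerT_pdle.
split=> //; split=> //.
have [n dn] := dX fV (inflT_finpd mM gY fY).
by exists n; exact: inflU_pdleK.
Qed.

Lemma tri_pdle m a b (X : umodule U) (V : umodule L) (Y : umodule T) :
  (forall j, pdle m (bi_col M (f j))) -> ses (iU X) V (iT Y) -> fin_gen Y ->
  pdle a X -> pdle b Y -> pdle (maxn a (b + m.+1)) V.
Proof.
move=> mM s gY dX dY; apply: (pdle_ext hL s).
  by apply: pdle_mono (leq_maxl _ _) _; exact: inflU_pdle.
by apply: pdle_mono (leq_maxr _ _) _; exact: inflT_pdle.
Qed.

Lemma inflT_pdleK n (Y : umodule T) : pdle n (iT Y) -> pdle n Y.
Proof.
(* Viewing [iT Y] as an extension of itself by zero makes Y a retract of its T-corner. *)
move=> dY; have s : ses (iU zero_mod) (iT Y) (iT Y).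
  by apply: ses_eq0; exact: zero_lmodule_eq0.
by apply: (pdle_retract hT (cornerT_ext s)); exact: cornerT_pdle.
Qed.

Lemma triple_ses (Y : umodule T) (X : umodule U) (phi : lm_hom (tensor M Y) X) :
  ses (iU X) (triple phi) (iT Y).
Proof.
have iB : zmod_morphism (fun x : iU X => ((0, x) : triple phi)).
  by move=> x y; congr (_, _); rewrite subr0.
have iZ r (x : iU X) : ((0, lact r x) : triple phi) = lact r ((0, x) : triple phi).
  by congr (_, _); rewrite /= ?lact0r // tens0r raddf0 add0r.
have pB : zmod_morphism (fun x : triple phi => (x.1 : iT Y)) by [].
exists (mkhom iB iZ), (@mkhom K L (triple phi) (iT Y) _ pB (fun _ _ => erefl)).
split=> /=; first by move=> x y [].
  by move=> y; exists (y, 0).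
by move=> [y x] /=; split=> [->|[z [<-]]] //; exists x.
Qed.

End Main.

(** * Suprema of dimensions *)

Section NatValued.
Local Open Scope ereal_scope.

(* rat is not complete, so a set of extended rationals need not have a supremum;
   one whose elements are naturals or +oo does. *)
Definition enat (x : \bar rat) := x = +oo \/ exists n : nat, x = n%:R%:E.

Lemma ereal_sup_max (S : set (\bar rat)) x : S x -> ubound S x -> ereal_sup S = x.
Proof.
move=> Sx ubx; apply/le_anti/andP; split; first exact: ge_ereal_sup.
apply: ge_supremum_Nmem => //; exists x; split=> // y; exact.
Qed.

Lemma lee_nat m n : (m%:R%:E <= n%:R%:E :> \bar rat) = (m <= n)%N.
Proof. by rewrite lee_fin ler_nat. Qed.

(** Either the set contains +oo, or its naturals are bounded and it has a maximum, or they are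
    unbounded and the archimedean property makes +oo the supremum. *)
Lemma enat_supremum (S : set (\bar rat)) : S `<=` enat -> S !=set0 ->
  exists x, supremums S x /\ (S x \/ x = +oo).
Proof.
move=> Se [x Sx].
have max y : S y -> ubound S y -> exists x, supremums S x /\ (S x \/ x = +oo).
  by move=> Sy uby; exists y; split; [split=> // z; exact | left].
have [Sy|nSy] := pselect (S +oo); first by apply: max Sy _ => y _; exact: leey.
pose P n := `[< S n%:R%:E >].
have Sn y : S y -> exists2 n, P n & y = n%:R%:E.
  move=> Sy; have [yy|[n yn]] := Se _ Sy; first by rewrite yy in Sy.
  by exists n => //; apply/asboolP; rewrite -yn.
have [[B BP]|nB] := pselect (exists B, forall n, P n -> (n <= B)%N).
  have exP : exists n, P n by have [n Pn _] := Sn _ Sx; exists n.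
  case: (ex_maxnP exP BP) => n /asboolP Pn nmax.
  by apply: max Pn _ => y /Sn[k Pk ->]; rewrite lee_nat; exact: nmax.
exists +oo; split; last by right.
split=> [y _|y Sub]; first exact: leey.
have big n : n%:R%:E <= y.
  apply: contrapT => /negP; rewrite -ltNge => yn; apply: nB.
  exists n => k /asboolP Sk.
  by rewrite -lee_nat; apply/ltW/le_lt_trans/yn/Sub.
case: y {Sub} big => [r|//|] big; last by have := big 0%N.
have := big (Num.bound `|r|%R); rewrite lee_fin leNgt.
by rewrite (le_lt_trans (ler_norm r)) // archi_boundP.
Qed.

Lemma enat_sup_ub (S : set (\bar rat)) : S `<=` enat -> ubound S (ereal_sup S).
Proof.
move=> Se x Sx; apply: ge_supremum_Nmem => //.
by have [|y [Sy _]] := enat_supremum Se; [exists x | exists y].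
Qed.

Lemma enat_sup_mem (S : set (\bar rat)) : S `<=` enat -> S !=set0 ->
  ereal_sup S < +oo -> S (ereal_sup S).
Proof.
move=> Se S0 Soo; have [x [[ubx lbx] Sx]] := enat_supremum Se S0.
have xE : ereal_sup S = x.
  by apply/le_anti/andP; split; [exact: ge_ereal_sup | exact/lbx/enat_sup_ub].
by case: Sx => [|xoo]; rewrite xE // in Soo *; rewrite xoo ltxx in Soo.
Qed.

Context {K : comPzRingType} {R : nuAlg K} (hR : local_units R).

Lemma pd_spec (N : umodule R) :
  (pd N = +oo /\ ~ finpd N) \/
  exists n : nat,
    [/\ pd N = n%:R%:E, pdle n N & forall k, pdle k N -> (n <= k)%N].
Proof.
have [fN|nfN] := pselect (finpd N); last first.
  left; split=> //; rewrite /pd -(ereal_inf0 rat); congr ereal_inf.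
  apply/seteqP; split=> // x [n [r rn] _]; case: nfN; exists n.
  exact: resolution_pdle rn.
right; have exN : exists n, `[< pdle n N >].
  by have [n dn] := fN; exists n; apply/asboolP.
case: (ex_minnP exN) => n /asboolP dn nmin; exists n; split=> //; last first.
  by move=> k dk; apply: nmin; apply/asboolP.
(* The infimum is defined as the opposite of the supremum of the opposites, and the least n makes
   that supremum a maximum. *)
rewrite /pd /ereal_inf -[RHS]oppeK; congr (- _); apply: ereal_sup_max.
  by exists n%:R%:E => //; exists n => //; exact: pdle_resolution.
move=> _ [y [k [r rk] <-] <-]; rewrite leeN2 lee_nat; apply: nmin.
by apply/asboolP; exact: resolution_pdle rk.
Qed.

Lemma pd_enat (N : umodule R) : enat (pd N).
Proof. by have [[-> _]|[n [-> _ _]]] := pd_spec N; [left | right; exists n]. Qed.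

Lemma pd_leP (N : umodule R) n : pd N <= n%:R%:E <-> pdle n N.
Proof.
have [[-> nf]|[m [-> dm mmin]]] := pd_spec N.
  by split=> // dn; case: nf; exists n.
by rewrite lee_nat; split=> [/pdle_mono|/mmin//]; apply.
Qed.

Lemma pd_finP (N : umodule R) : pd N < +oo <-> finpd N.
Proof.
have [[-> nf]|[m [-> dm mmin]]] := pd_spec N; first by rewrite ltxx.
by rewrite ltry; split=> // _; exists m.
Qed.

Lemma pd_class_ub (C : umodule R -> Prop) N : C N -> pd N <= pd_class C.
Proof.
move=> CN; apply: enat_sup_ub; last by exists N.
by move=> _ [N' [_ ->]]; exact: pd_enat.
Qed.

End NatValued.

Lemma pd_le_pd {K : comPzRingType} {R S : nuAlg K} (hR : local_units R)
    (hS : local_units S) (N : umodule R) (N' : umodule S) :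
  (forall n, pdle n N' -> pdle n N) -> (pd N <= pd N')%E.
Proof.
move=> NN'; have [[-> _]|[n [-> dn _]]] := pd_spec hS N'; first exact: leey.
exact/(pd_leP hR)/NN'.
Qed.

Local Open Scope ereal_scope.

Theorem theoremB (K : comPzRingType) (I J : choiceType)
    (U : nuAlg K) (e : I -> U) (T : nuAlg K) (f : J -> T)
    (M : bimodule U T)
    (I_nonempty : inhabited I) (J_nonempty : inhabited J)
    (U_basic : basic e) (T_basic : basic f)
    (M_length : forall i j, finite_length (bi_peirce M (e i) (f j)))
    (supp_fin : support_finite (tri_idem M e f)) :
  (forall (Y : umodule T) (X : umodule U) (phi : lm_hom (tensor M Y) X),
     (forall j, pd (bi_col M (f j)) < +oo) ->
     (fin_pd_class (triple phi) <-> fin_pd_class Y /\ fin_pd_class X))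
  /\
  (let m := ereal_sup [set pd (bi_col M (f j)) | j in [set: J]] in
   m < +oo ->
   (Order.max (gldim U - m) (gldim T) <= gldim (tri_alg M)
      <= Order.max (gldim U) (gldim T + 1 + m)) /\
   (Order.max (findim U - m) (findim T) <= findim (tri_alg M)
      <= Order.max (findim U) (findim T + 1 + m))).
Proof.
have [eI eL _ _] := U_basic; have [fI fL _ _] := T_basic.
have eU := enough_idempotents_units eI; have fU := enough_idempotents_units fI.
have gU := tri_idem_units (M := M) eU fU.
have [ee _ _ _] := eI; have [ff _ _ _] := fI.
have gg := tri_idem_idem M ee ff.
have hU := idem_units_local eU; have hT := idem_units_local fU.
have hL := idem_units_local gU.
have eN i : noetherian (left_mod hU (e i)).
  apply: (left_mod_noetherian eU ee).
    exact: (tri_supportU (supp_fin (inl i)).1).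
  by move=> k; exact/finite_length_noetherianK.
have fN j : noetherian (left_mod hT (f j)).
  apply: (left_mod_noetherian fU ff).
    exact: (tri_supportT (supp_fin (inr j)).1).
  by move=> k; exact/finite_length_noetherianK.
have gN r : noetherian (left_mod hL (tri_idem M e f r)).
  apply: (left_mod_noetherian gU gg); first exact: (supp_fin r).1.
  by move=> k; exact: tri_peirce_noetherian.
have fpU (N : umodule U) := pd_finP hU N.
have fpT (N : umodule T) := pd_finP hT N.
have fpL (N : umodule (tri_alg M)) := pd_finP hL N.
have tri_class X (V : umodule (tri_alg M)) Y : (forall j, finpd (bi_col M (f j))) ->
    ses (infl (prU_morph M) hU (@prU_surj K U T M) X) V
        (infl (prT_morph M) hT (@prT_surj K U T M) Y) ->
    fin_pd_class V <-> fin_pd_class Y /\ fin_pd_class X.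
  move=> mM s; rewrite /fin_pd_class fpU fpT fpL.
  exact: (tri_fin_pd ee ff gg eU fU gU eN fN gN mM s).
split=> [Y X phi mM|m moo].
  by apply: tri_class; [move=> j; exact/fpU | exact: triple_ses].
pose iU := infl (prU_morph M) hU (@prU_surj K U T M).
pose iT := infl (prT_morph M) hT (@prT_surj K U T M).
have enat_m : [set pd (bi_col M (f j)) | j in [set: J]] `<=` enat.
  by move=> _ [j _ <-]; exact: pd_enat.
have [m0 mE mM] : exists2 m0 : nat,
    m = m0%:R%:E & forall j, pdle m0 (bi_col M (f j)).
  (* A finite supremum of such values is attained, so m is the dimension of an actual column; the
     index j0 excludes the empty supremum, which is -oo. *)
  have [j0] := J_nonempty.
  have [|//|j _ mE] := enat_sup_mem enat_m.
    by exists (pd (bi_col M (f j0))), j0.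
  have [[poo _]|[n [pn _ _]]] := pd_spec hU (bi_col M (f j)).
    by move: moo; rewrite /m -mE poo ltxx.
  exists n; first by rewrite /m -mE.
  by move=> i; apply/(pd_leP hU); rewrite -pn mE; apply: enat_sup_ub => //; exists i.
have mfin j : finpd (bi_col M (f j)) by exists m0.
have giU X := fin_gen_infl (prU_morph M) hU (@prU_surj K U T M) hL X.
have giT Y := fin_gen_infl (prT_morph M) hT (@prT_surj K U T M) hL Y.
have pd_iU X : fin_gen X -> pd X <= pd (iU X).
  by move=> gX; apply: (pd_le_pd hU hL) => n; exact: (inflU_pdleK hL ee eU eN).
have pd_iT Y : pd Y <= pd (iT Y).
  by apply: (pd_le_pd hT hL) => n; exact: inflT_pdleK.
(* X and Y are the two corners of V. The equivalences place them in the same class as V, so this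
   single bound serves both upper estimates. *)
have upper (V : umodule (tri_alg M)) : fin_gen V ->
    exists (X : umodule U) (Y : umodule T),
  [/\ fin_gen V <-> fin_gen Y /\ fin_gen X,
    fin_pd_class V <-> fin_pd_class Y /\ fin_pd_class X
    & pd V <= Order.max (pd X) (pd Y + 1 + m)].
  move=> gV; have s := corner_tri_ses hU hT hL V.
  exists (corner (inU_morph M) hU V), (corner (inT_morph M) hT V).
  have gE := tri_fin_gen gg gU gN s; split; [by []|exact: tri_class|].
  have [gY gX] := gE.1 gV; rewrite mE.
  have [[-> _]|[a [-> da _]]] := pd_spec hU (corner (inU_morph M) hU V).
    by rewrite maxye leey.
  have [[-> _]|[b [-> db _]]] := pd_spec hT (corner (inT_morph M) hT V).
    by rewrite -addeA addye // maxey leey.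
  have dV := tri_pdle hL ff gg fU fN mM s gY da db.
  apply: le_trans ((pd_leP hL _ _).2 dV) _.
  rewrite -!EFinD natr1 -natrD addSnnS /maxn; case: ifP => _.
    by rewrite le_max lexx orbT.
  by rewrite le_max lexx.
(* Since m is a natural number, subtracting it only weakens an inequality; both lower estimates are
   first proved without the shift. *)
have lowerU (x y : \bar rat) : x <= y -> x - m <= y.
  move=> xy; rewrite mE leeBlDr //; apply: le_trans xy _; apply: leeDl.
  by rewrite lee_fin ler0n.
split; rewrite ge_max; apply/andP; split.
- apply/andP; split.
    apply: lowerU; apply: ge_ereal_sup => _ [X [gX ->]].
    apply: le_trans (pd_iU X gX) _; apply: (pd_class_ub hL); exact/giU.
  apply: ge_ereal_sup => _ [Y [gY ->]].
  by apply: le_trans (pd_iT Y) _; apply: (pd_class_ub hL); exact/giT.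
- apply: ge_ereal_sup => _ [V [gV ->]].
  have [X [Y [/iffLR/(_ gV)[gY gX] _ pV]]] := upper V gV; apply: le_trans pV _.
  rewrite ge_max !le_max; apply/andP; split; apply/orP; [left|right].
    exact: (pd_class_ub hU).
  by do 2!apply: leeD2r; exact: (pd_class_ub hT).
- apply/andP; split.
    apply: lowerU; apply: ge_ereal_sup => _ [X [[gX fX] ->]].
    apply: le_trans (pd_iU X gX) _; apply: (pd_class_ub hL); split; first exact/giU.
    by apply/fpL; have /fpU[n dn] := fX; exists n; exact: inflU_pdle.
  apply: ge_ereal_sup => _ [Y [[gY fY] ->]].
  apply: le_trans (pd_iT Y) _; apply: (pd_class_ub hL); split; first exact/giT.
  by apply/fpL; have /fpT := fY; exact: (inflT_finpd hU hL ff gg fU fN).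
- apply: ge_ereal_sup => _ [V [fV ->]].
  have [X [Y [_ /iffLR/(_ fV)[fY fX] pV]]] := upper V fV.1; apply: le_trans pV _.
  rewrite ge_max !le_max; apply/andP; split; apply/orP; [left|right].
    exact: (pd_class_ub hU).
  by do 2!apply: leeD2r; exact: (pd_class_ub hT).
Qed.
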